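(* Let $d\ge 1$ be an integer. Let $\mathcal{X}_d$ be the family of all graphs $X_{f,q}$, where $q$ ranges over odd prime powers and $f\in\mathbb{F}_q[x,y]$ ranges over admissible polynomials of degree $d$. Then $\mathcal{X}_d$ is a family of quasi-random graphs with property $QR(3/4)$: there is a constant $c>0$ (depending only on $d$) such that for every $X_{f,q}\in\mathcal{X}_d$ and all subsets $S,T\subset\mathbb{F}_q$, $$\left|e(S,T)-\frac{|S||T|}{2}\right|\le c\,q^{3/4}\sqrt{|S||T|}.$$
   Context: $q$ is an odd prime power and $\mathbb{F}_q$ the field with $q$ elements; an element of $\mathbb{F}_q$ is a square if it equals $z^2$ for some $z\in\mathbb{F}_q$ (so $0$ is a square). For $f\in\mathbb{F}_q[x,y]$, $X_{f,q}$ is the simple graph (no loops) with vertex set $\mathbb{F}_q$ in which distinct $a,b$ are adjacent iff $f(a,b)$ is a square in $\mathbb{F}_q$. Every $f$ can be written $f(x,y)=F(x)G(y)H(x,y)$ with $F\in\mathbb{F}_q[x]$, $G\in\mathbb{F}_q[y]$ and $H$ primitive in both $x$ and $y$ (i.e. $H$ has no nonconstant factor lying in $\mathbb{F}_q[x]$ or in $\mathbb{F}_q[y]$); $H$, unique up to a constant factor, is the primitive kernel of $f$. The polynomial $f$ is admissible if (i) for all $u,v\in\mathbb{F}_q$, $f(u,v)$ is a square iff $f(v,u)$ is a square, and (ii) $H$ is not a constant multiple of the square of a polynomial in $\mathbb{F}_q[x,y]$. For a graph $G$ and vertex subsets $S,T$, $e(S,T)$ is the number of pairs $(s,t)\in S\times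 T$ with $s,t$ adjacent (edges with both endpoints in $S\cap T$ are counted twice). For $0<\theta<1$, a family $\mathcal{G}$ of graphs with unbounded numbers of vertices has property $QR(\theta)$ if there is $c>0$ such that for all $G\in\mathcal{G}$ with $n$ vertices and all $S,T\subset V(G)$, $|e(S,T)-|S||T|/2|\le c n^\theta\sqrt{|S||T|}$. *)

(* Defs.v *)
From HB Require Import structures.
From mathcomp Require Import all_boot all_order all_algebra.
From mathcomp Require Import reals exp.
Set Implicit Arguments.
Unset Strict Implicit.
Unset Printing Implicit Defensive.
Import Order.TTheory GRing.Theory Num.Theory.
Local Open Scope ring_scope.

Record sgraph := SGraph {
  vertex :> finType;
  adj : rel vertex;
  adj_sym : symmetric adj;
  adj_irrefl : irreflexive adj }.

(* Ordered pairs, so an edge inside S :&: T is counted twice. *)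
Definition edge_count (X : sgraph) (S T : {set X}) : nat :=
  #|[set st in setX S T | adj st.1 st.2]|.

Definition graph_family := sgraph -> Prop.

Definition unbounded_order (Xs : graph_family) : Prop :=
  forall N : nat, exists2 X : sgraph, Xs X & (N <= #|X|)%N.

Definition has_QR (R : realType) (theta : R) (Xs : graph_family) : Prop :=
  unbounded_order Xs /\
  exists2 c : R, 0 < c &
    forall X : sgraph, Xs X -> forall S T : {set X},
      `| (edge_count S T)%:R - (#|S| * #|T|)%:R / 2 |
        <= c * (#|X|%:R `^ theta)%R * Num.sqrt (#|S| * #|T|)%:R.

(* F[x,y] is {poly {poly F}} with the conventions of polyXY: x is the outer
   variable and y the inner one, so p^:P is p(x), p%:P is p(y), and
   f.[a, b] is f(a, b). *)

(* Total degree (0 for the zero polynomial). *)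
Definition tdeg (F : fieldType) (f : {poly {poly F}}) : nat :=
  \max_(i < size f | f`_i != 0) (i + (size (f`_i)%R).-1)%N.

Definition is_square (F : finFieldType) (a : F) : bool :=
  [exists z : F, a == z ^+ 2].

(* Divisibility is spelled out because %| on {poly {poly F}} is only
   pseudo-divisibility. The zero polynomial is not primitive. *)
Definition primitive_xy (F : fieldType) (H : {poly {poly F}}) : Prop :=
  (forall (p : {poly F}) (g : {poly {poly F}}),
      H = p^:P * g -> (size p <= 1)%N) /\
  (forall (p : {poly F}) (g : {poly {poly F}}),
      H = p%:P * g -> (size p <= 1)%N).

Definition primitive_kernel (F : fieldType) (f H : {poly {poly F}}) : Prop :=
  primitive_xy H /\ exists Fx Gy : {poly F}, f = Fx^:P * Gy%:P * H.

Definition square_symmetric (F : finFieldType) (f : {poly {poly F}}) : Prop :=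
  forall u v : F, is_square f.[u, v] = is_square f.[v, u].

(* A nonzero f has a primitive kernel, unique up to a nonzero constant, and
   the condition on H is invariant under such constants. *)
Definition admissible (F : finFieldType) (f : {poly {poly F}}) : Prop :=
  square_symmetric f /\
  forall H : {poly {poly F}}, primitive_kernel f H ->
    ~ exists (c : F) (P : {poly {poly F}}), H = c%:P%:P * P ^+ 2.

Definition Xadj (F : finFieldType) (f : {poly {poly F}}) : rel F :=
  fun a b => (a != b) && is_square f.[a, b].

Lemma Xadj_sym (F : finFieldType) (f : {poly {poly F}}) :
  square_symmetric f -> symmetric (Xadj f).
Proof. by move=> symf a b; rewrite /Xadj eq_sym symf. Qed.

Lemma Xadj_irrefl (F : finFieldType) (f : {poly {poly F}}) :
  irreflexive (Xadj f).
Proof. by move=> a; rewrite /Xadj eqxx. Qed.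

Definition Xgraph (F : finFieldType) (f : {poly {poly F}})
    (symf : square_symmetric f) : sgraph :=
  SGraph (Xadj_sym symf) (@Xadj_irrefl F f).

Inductive X_family (d : nat) : graph_family :=
  XFamily (F : finFieldType) (f : {poly {poly F}}) (adm_f : admissible f) of
    odd #|F| & tdeg f = d : X_family d (Xgraph (proj1 adm_f)).

(* Main.v *)
(* Let A be the matrix with entries 1 or -1 according to adjacency. By
   Cauchy-Schwarz the square of the sum of A over S x T is at most |S| times the
   sum over t, u in T of the scalar products of columns t and u of A. Up to O(1)
   entries such a scalar product is the quadratic character sum of
   f(x,t) f(x,u), and Stepanov's method bounds it by O(sqrt q) unless
   f(x,t) f(x,u) is a constant times a square in F[x].
   The exceptional pairs number O(q). An approximate square root of the
   primitive kernel H, computed over F[y] in powers of x, shows that H(x,t) is a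
   constant times a square for O(1) values of t only. For every other t some
   irreducible r divides H(x,t) to an odd power, and primitivity of H lets r
   divide H(x,u) for at most deg_y H values of u.
   So the scalar products add up to O(q |T| + |T|^2 sqrt q), which is
   O(q^(3/2) |T|). *)
Require Import Defs.
From HB Require Import structures.
From mathcomp Require Import all_boot all_order all_algebra all_field.
From mathcomp Require Import boolp reals exp cyclic.
From mathcomp Require Import zify ring lra.
Import Order.TTheory GRing.Theory Num.Theory.
Set Implicit Arguments.
Unset Strict Implicit.
Unset Printing Implicit Defensive.
Local Open Scope ring_scope.

(** * Stepanov's method *)

(** In other words, [f] is not a constant times a square in the field of rational functions, with
    denominators cleared into [r]. Since [c = 0] is allowed, this forces [f] to be nonzero. *)
Definition nonsquare_poly (F : fieldType) (f : {poly F}) : Prop :=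
  forall (r s : {poly F}) (c : F), f * r ^+ 2 = c *: s ^+ 2 -> r = 0.

Lemma nonsquare_poly_neq0 (F : fieldType) (f : {poly F}) :
  nonsquare_poly f -> f != 0.
Proof.
move=> nsf; apply: contra_eq_neq (oner_eq0 {poly F}) => f0.
by rewrite (nsf 1 0 0) ?eqxx // f0 mul0r scale0r.
Qed.

Lemma exprD_card (F : finFieldType) (p r : {poly F}) :
  (p + r) ^+ #|F| = p ^+ #|F| + r ^+ #|F|.
Proof.
have [p0 pr_p chF] := finPcharP F.
rewrite exprDn_pchar //; have [n cardF] : exists n, #|F| = (p0 ^ n)%N.
  by rewrite (card_primeChar chF); eexists.
by rewrite cardF pnatX pnatE // pchar_poly chF.
Qed.

(** Powers of ['X - x%:P] at distinct points are coprime, so their product, of degree [l * #|S|],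
    divides [r]. *)
Lemma dvdp_prod_XsubC_exp (F : finFieldType) (S : {set F}) (l : nat)
    (r : {poly F}) :
  r != 0 -> (forall x, x \in S -> ('X - x%:P) ^+ l %| r) ->
  (l * #|S| < size r)%N.
Proof.
move=> r0 dvdr; have: \prod_(x in S) ('X - x%:P) ^+ l %| r.
  have: uniq (enum S) by rewrite enum_uniq.
  have: forall x, x \in enum S -> ('X - x%:P) ^+ l %| r.
    by move=> x; rewrite mem_enum; apply: dvdr.
  rewrite -big_enum; elim: (enum S) => [|x s IHs] dvds /=.
    by rewrite big_nil dvd1p.
  move=> /andP[xs us]; rewrite big_cons Gauss_dvdp.
    rewrite dvds ?mem_head //=; apply: IHs => // y ys.
    by apply: dvds; rewrite inE ys orbT.
  rewrite big_seq; apply: (big_ind (fun p => coprimep _ p)).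
  - exact: coprimep1.
  - by move=> p1 p2 c1 c2; rewrite coprimepMr c1.
  - move=> y ys; apply: coprimep_expl; apply: coprimep_expr.
    rewrite coprimep_XsubC root_XsubC; apply: contraNneq xs => <- //.
move=> /(dvdp_leq r0); rewrite size_prod => [|x _]; last first.
  by rewrite expf_eq0 polyXsubC_eq0 andbF.
under eq_bigr => x _ do rewrite size_exp_XsubC.
have -> : #|in_mem^~ (mem S)| = #|S| by apply: eq_card.
by rewrite sum_nat_const mulnS subSn ?leq_addr // addKn mulnC.
Qed.

(** Counting replaces rank arguments for a homogeneous linear system: two functions have the same
    image by cardinality, and additivity makes their difference a nonzero solution. *)
Lemma additive_pigeonhole (F : finFieldType) (A B : finType)
    (phi : {ffun A -> F} -> B -> F) :
  (forall u v b, phi (u - v) b = phi u b - phi v b) -> (#|B| < #|A|)%N ->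
  exists2 u, u != 0 & forall b, phi u b = 0.
Proof.
move=> phiB ltBA; pose g u := [ffun b => phi u b].
have /injectivePn[u [v neq_uv eq_g]] : ~~ injectiveb g.
  apply/negP => /injectiveP /leq_card; rewrite !card_ffun leqNgt => /negP[].
  by rewrite ltn_exp2l // finNzRing_gt1.
exists (u - v); first by rewrite subr_eq0.
by move=> b; rewrite phiB; move/ffunP/(_ b): eq_g; rewrite !ffunE => ->; rewrite subrr.
Qed.

Section Stepanov.
Variables (F : finFieldType) (f : {poly F}) (b : F) (n : nat).
Local Notation q := #|F|.
Local Notation c := (#|F|./2).
Hypothesis q_odd : odd q.

Section Independence.
Hypotheses (nsf : nonsquare_poly f) (fb : f.[b] != 0).
Hypothesis size_fn : (size f + n.*2 <= q + 2)%N.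

(* Squaring r = - s f^((q-1)/2) and using f^q = f(b) mod (X-b)^q gives
   f r^2 = f(b) s^2 mod (X-b)^q, an identity between polynomials of degree < q. *)
Lemma stepanov_independent1 (r s : {poly F}) :
  (size r <= n)%N -> (size s <= n)%N ->
  ('X - b%:P) ^+ q %| r + s * f ^+ c -> r = 0 /\ s = 0.
Proof.
move=> szr szs dvd_rs.
have [n0|n_gt0] := posnP n.
  by move: szr szs; rewrite n0 !leqn0 !size_poly_eq0 => /eqP-> /eqP->.
have Dq : q = (c * 2).+1 by rewrite muln2 -[LHS]odd_double_half q_odd.
have fqE : f ^+ q = f * (f ^+ c) ^+ 2 by rewrite {1}Dq exprS exprM.
have fq : ('X - b%:P) ^+ q %| f ^+ q - (f.[b])%:P.
  have /factor_theorem[h Dh] : root (f - (f.[b])%:P) b.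
    by rewrite rootE !hornerE subrr.
  rewrite -{1}[f](subrK (f.[b])%:P f) (exprD_card (f - _)) -polyC_exp expf_card.
  by rewrite addrK Dh exprMn dvdp_mulIr.
have: f * r ^+ 2 - f.[b] *: s ^+ 2 = 0.
  apply/eqP; apply: contraTT dvd_rs => nz; apply/negP => dvd_rs.
  have: ('X - b%:P) ^+ q %| f * r ^+ 2 - f.[b] *: s ^+ 2.
    have -> : f * r ^+ 2 - f.[b] *: s ^+ 2 =
       (r + s * f ^+ c) * (f * (r - s * f ^+ c)) + s ^+ 2 * (f ^+ q - (f.[b])%:P).
      by rewrite -mul_polyC fqE; ring.
    by apply: dvdp_add; [apply: dvdp_mulr | apply: dvdp_mull].
  move=> /(dvdp_leq nz); rewrite size_exp_XsubC leqNgt => /negP[].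
  (* Hypothesis [size_fn] says exactly that [deg f + 2 (n - 1) < q], so both terms have degree below
     [q]. *)
  rewrite ltnS (leq_trans (size_polyD _ _)) // size_polyN geq_max.
  have sz2 (p : {poly F}) : (size p <= n)%N -> (size (p ^+ 2) <= n.*2.-1)%N.
    by move=> szp; rewrite expr2 (leq_trans (size_polyMleq _ _)); lia.
  rewrite (leq_trans (size_polyMleq _ _)) /=; last first.
    by move: size_fn n_gt0 (sz2 _ szr); move: (size f) (size (r ^+ 2)) #|F|; clear; lia.
  rewrite (leq_trans (size_scale_leq _ _)) // (leq_trans (sz2 _ szs)) //.
  have : size f != 0%N by rewrite size_poly_eq0; apply: nonsquare_poly_neq0.
  by move: size_fn n_gt0; move: (size f) #|F|; clear; lia.
move=> /eqP; rewrite subr_eq0 => /eqP eq_rs.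
have r0 := nsf eq_rs; split=> //; move: eq_rs; rewrite r0 expr0n mulr0.
by move=> /esym/eqP; rewrite scaler_eq0 (negPf fb) sqrf_eq0 => /eqP.
Qed.

(** Modulo [('X - b%:P) ^+ q] only the term [j = 0] survives, so it vanishes by the previous lemma;
    dividing by that power leaves a shorter sum. *)
Lemma stepanov_independent (J : nat) (r s : nat -> {poly F}) :
  (forall j, (size (r j) <= n)%N) -> (forall j, (size (s j) <= n)%N) ->
  \sum_(j < J) (r j + s j * f ^+ c) * (('X - b%:P) ^+ q) ^+ j = 0 ->
  forall j, (j < J)%N -> r j = 0 /\ s j = 0.
Proof.
elim: J r s => [|J IHJ] r s szr szs //.
rewrite big_ord_recl /= expr0 mulr1.
under eq_bigr => i _ do rewrite [bump 0 i]add1n exprSr mulrA.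
rewrite -mulr_suml => eq0.
have [r0 s0] : r 0 = 0 /\ s 0 = 0.
  apply: stepanov_independent1 => //.
  by move: eq0 => /eqP; rewrite addr_eq0 => /eqP ->; rewrite dvdpNr dvdp_mulIr.
move: eq0; rewrite r0 s0 mul0r addr0 add0r => /eqP; rewrite mulf_eq0.
rewrite [X in _ || X]expf_eq0 polyXsubC_eq0 andbF orbF => /eqP eq0.
by case=> [|j] // ltj; apply: (IHJ (fun j => r j.+1) (fun j => s j.+1)).
Qed.
End Independence.

Section Vanishing.
Variables (l J : nat).
Hypothesis le_lc : (l <= c)%N.

(* f(X)^l f(X+T)^c = f(X)^c * stepanov_binom mod T^l, with 'X and 'Y playing
   the roles of T and X. *)
Definition stepanov_binom (l : nat) : {poly {poly F}} :=
  \sum_(i < l) ((f ^+ (l - i))%:P * (poly_XaY f - f%:P) ^+ i) *+ 'C(c, i).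

(** Stepanov's auxiliary polynomial. Expanded around a point [x] to an order below [q], the powers
    of [('X - b%:P) ^+ q] behave like powers of the constant [x - b]. *)
Definition stepanov_sum (r s : nat -> {poly F}) : {poly F} :=
  \sum_(j < J) (r j + s j * f ^+ c) * (('X - b%:P) ^+ q) ^+ j.

(* At a point x with f(x)^c = 1 this is f(x)^l times the expansion of
   stepanov_sum at x + T, modulo T^l. *)
Definition stepanov_expansion (r s : nat -> {poly F}) : {poly {poly F}} :=
  \sum_(j < J) ((f ^+ l)%:P * poly_XaY (r j) + poly_XaY (s j) * stepanov_binom l)
    * (('X - b%:P) ^+ j)%:P.

Lemma map_eval_poly_XaY (x : F) (p : {poly F}) :
  map_poly (horner_eval x) (poly_XaY p) = p \Po ('X + x%:P).
Proof.
by rewrite -horner_swapXY swapXY_poly_XaY horner_poly_XaY addrC.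
Qed.

(** After the translation by [x], the sum times [f(x)^l] agrees modulo ['X^l] with the expansion
    evaluated at [x], whose coefficients below [l] vanish; and [f(x)] is nonzero. *)
Lemma stepanov_sum_vanish (r s : nat -> {poly F}) (x : F) :
  f.[x] ^+ c = 1 ->
  (forall k, (k < l)%N -> (stepanov_expansion r s)`_k = 0) ->
  ('X - x%:P) ^+ l %| stepanov_sum r s.
Proof.
move=> fx1 exp0.
have fx0 : f.[x] != 0.
  apply: contra_eq_neq fx1 => ->; rewrite expr0n eq_sym.
  have := finNzRing_gt1 F; case: (c =P 0%N) => [c0|_ _]; last by rewrite oner_eq0.
  by rewrite -[q]odd_double_half q_odd c0.
pose ev := map_poly (horner_eval x).
pose sh (p : {poly F}) := p \Po ('X + x%:P).
pose fx := (f.[x])%:P.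
have evC (p : {poly F}) : ev p%:P = (p.[x])%:P by rewrite /ev map_polyC.
have dvdW : 'X %| sh f - fx.
  rewrite -['X]subr0 -polyC0 dvdp_XsubCl rootE !hornerE horner_comp !hornerE.
  by rewrite subrr.
pose W := sh f - fx.
have evB : ev (stepanov_binom l) =
    \sum_(i < l) (fx ^+ (l - i) * W ^+ i) *+ 'C(c, i).
  rewrite /stepanov_binom /ev rmorph_sum; apply: eq_bigr => i _.
  rewrite rmorphMn rmorphM /= -/ev evC horner_exp polyC_exp.
  by rewrite /ev rmorphXn rmorphB /= map_eval_poly_XaY -/ev evC.
have dvdB : 'X^l %| fx ^+ l * sh f ^+ c - ev (stepanov_binom l).
  have -> : sh f = fx + W by rewrite addrC subrK.
  rewrite exprDn evB.
  (* The binomial expansion is cut at [l]. Later terms contain [W ^+ l], hence ['X^l]; in the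
     earlier ones [fx ^+ c = 1] reduces the power of [fx] to [l - i]. *)
  have -> : c.+1 = (l + (c.+1 - l))%N by lia.
  rewrite big_split_ord /= mulrDr addrAC mulr_sumr -sumrB.
  rewrite big1 ?add0r.
    apply/dvdp_mull/(big_ind (fun p => 'X^l %| p)) => [|p1 p2|i _].
    - exact: dvdp0.
    - exact: dvdp_add.
    - rewrite -mulr_natr; apply/dvdp_mulr/dvdp_mull; rewrite exprD.
      by apply: dvdp_mulr; apply: dvdp_exp2r.
  move=> i _; rewrite mulrnAr mulrA -exprD.
  have -> : (l + (c - i) = c + (l - i))%N by case: i => i /= ltil; lia.
  by rewrite exprD -[fx ^+ c]polyC_exp fx1 mul1r subrr.
have dvdev : 'X^l %| ev (stepanov_expansion r s).
  apply/modp_eq0P/polyP => i.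
  rewrite coef0; have [le_li|lt_il] := leqP l i.
    rewrite nth_default //; apply: leq_trans le_li.
    by rewrite -ltnS -(size_polyXn F l) ltn_modp expf_neq0 // polyX_eq0.
  have := divp_eq (ev (stepanov_expansion r s)) 'X^l.
  move/(congr1 (fun p : {poly F} => p`_i)).
  rewrite coefD coefMXn lt_il add0r => <-.
  by rewrite coef_map exp0 //= rmorph0.
(* By Frobenius the translated [q]-th power is ['X^q] plus the constant [x - b], and
   [l <= c <= q]. *)
have dvdq : 'X^l %| sh (('X - b%:P) ^+ q) - ('X - b%:P).[x]%:P.
  rewrite /sh rmorphXn /= rmorphB /= comp_polyX comp_polyC -addrA exprD_card.
  rewrite -polyCB -polyC_exp expf_card !hornerE addrK.
  by apply: dvdp_exp2l; lia.
have: 'X^l %| fx ^+ l * sh (stepanov_sum r s) - ev (stepanov_expansion r s).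
  rewrite /stepanov_sum /stepanov_expansion /sh /ev !rmorph_sum mulr_sumr -sumrB.
  apply: (big_ind (fun p => 'X^l %| p)) => [|p1 p2|j _]; first exact: dvdp0.
    exact: dvdp_add.
  rewrite /=.
  set A := sh (_ ^+ q) in dvdq; set B := _.[x]%:P in dvdq.
  set fc := sh f ^+ c in dvdB.
  have -> : ((r j + s j * f ^+ c) * ('X - b%:P) ^+ q ^+ j) \Po ('X + x%:P) =
      (sh (r j) + sh (s j) * fc) * A ^+ j.
    by rewrite /A /fc /sh !(rmorphM, rmorphD, rmorphXn).
  have -> : map_poly (horner_eval x)
      (((f ^+ l)%:P * poly_XaY (r j) + poly_XaY (s j) * stepanov_binom l) *
       (('X - b%:P) ^+ j)%:P) =
      (fx ^+ l * sh (r j) + sh (s j) * ev (stepanov_binom l)) * B ^+ j.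
    rewrite rmorphM rmorphD !rmorphM /= -/ev !evC !horner_exp !polyC_exp.
    by rewrite /ev !map_eval_poly_XaY.
  have -> : fx ^+ l * ((sh (r j) + sh (s j) * fc) * A ^+ j) -
      (fx ^+ l * sh (r j) + sh (s j) * ev (stepanov_binom l)) * B ^+ j =
     (A ^+ j - B ^+ j) * (fx ^+ l * sh (r j) + sh (s j) * (fx ^+ l * fc)) +
     (fx ^+ l * fc - ev (stepanov_binom l)) * (sh (s j) * B ^+ j).
    by ring.
  apply: dvdp_add; last exact: dvdp_mulr.
  by apply: dvdp_mulr; rewrite subrXX dvdp_mulr.
move=> dvdd; have: 'X^l %| fx ^+ l * sh (stepanov_sum r s).
  rewrite -[fx ^+ l * _](subrK (ev (stepanov_expansion r s))).
  exact: dvdp_add.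
rewrite -polyC_exp mul_polyC dvdpZr ?expf_neq0 //.
move=> /(dvdp_comp_poly ('X - x%:P)); rewrite rmorphXn /= comp_polyX.
by rewrite /sh -comp_polyA rmorphD /= comp_polyX comp_polyC subrK comp_polyXr.
Qed.
End Vanishing.
End Stepanov.

(** * Degree bounds in the inner variable *)

Lemma sizeYD_leq (F : fieldType) (u v : {poly {poly F}}) k :
  (sizeY u <= k)%N -> (sizeY v <= k)%N -> (sizeY (u + v) <= k)%N.
Proof.
rewrite !sizeYE rmorphD => szu szv.
by rewrite (leq_trans (size_polyD _ _)) // geq_max szu.
Qed.

Lemma sizeYN (F : fieldType) (u : {poly {poly F}}) : sizeY (- u) = sizeY u.
Proof. by rewrite !sizeYE raddfN size_polyN. Qed.

Lemma sizeY_sum_leq (F : fieldType) (I : finType) (G : I -> {poly {poly F}}) k :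
  (forall i, (sizeY (G i) <= k)%N) -> (sizeY (\sum_i G i) <= k)%N.
Proof.
move=> szG; apply: (big_ind (fun u => (sizeY u <= k)%N)) => [|u v|i _] //.
  by rewrite sizeYE rmorph0 size_poly0.
exact: sizeYD_leq.
Qed.

Lemma sizeYM_leq (F : fieldType) (u v : {poly {poly F}}) i j :
  (sizeY u <= i.+1)%N -> (sizeY v <= j)%N -> (sizeY (u * v) <= i + j)%N.
Proof.
rewrite !sizeYE rmorphM => szu szv; rewrite (leq_trans (size_polyMleq _ _)) //.
by rewrite -subn1 leq_subLR addnA add1n leq_add.
Qed.

Lemma sizeYX_leq (F : fieldType) (u : {poly {poly F}}) i k :
  (sizeY u <= i.+1)%N -> (sizeY (u ^+ k) <= (k * i).+1)%N.
Proof.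
rewrite !sizeYE rmorphXn => szu; rewrite (leq_trans (size_poly_exp_leq _ _)) //.
by rewrite ltnS mulnC leq_mul2l; case: (size _) szu => [|j] /=; lia.
Qed.

Lemma sizeYC (F : fieldType) (p : {poly F}) : sizeY p%:P = size p.
Proof. by rewrite sizeYE swapXY_polyC size_map_polyC. Qed.

Lemma sizeY_poly_XaY (F : fieldType) (p : {poly F}) : sizeY (poly_XaY p) = size p.
Proof. by rewrite sizeYE swapXY_poly_XaY size_poly_XaY. Qed.

(** The parameters are [l = 2 s], [J = s + 8 m + 8] and [n] about [(q - m) / 2], where [s] is the
    integer part of the square root of [q]. In the count of unknowns against equations the terms
    [2 s n] cancel, and the excess [8 m + 8] in [J] pays for the rest. Dividing the final bound by
    [s] uses [q <= s (s + 2)]. *)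
Lemma stepanov_arith (m s q n c sf N : nat) :
  (8 * m + 9 <= s -> s * s <= q -> q < s.+1 * s.+1 ->
  n.*2 <= q - m -> q - m <= n.*2.+1 -> 2 * c <= q -> q <= 2 * c + 1 ->
  sf <= m.+1 ->
  (2 * s <= c -> sf + n.*2 <= q + 2 ->
   2 * s * (2 * s * m + n + (s + 8 * m + 8)) < 2 * ((s + 8 * m + 8) * n) ->
   2 * s * N <= q * (s + 8 * m + 8) + c * m + n) ->
  2 * N <= q + s * (27 * m + 27))%N.
Proof.
move=> large le_sq lt_qs le_n ge_n c2 c2' le_sf.
have le1 : (s * (8 * m + 9) <= q)%N.
  by rewrite (leq_trans _ le_sq) // leq_mul2l large orbT.
have le2 : ((8 * m + 9) * (8 * m + 9) <= q)%N.
  by rewrite (leq_trans _ le1) // leq_mul2r large orbT.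
have le3 : (s * s * m <= q * m)%N by rewrite leq_mul2r le_sq orbT.
have [t Dq] : exists t, q = (t + m + 1)%N by exists (q - m - 1)%N; lia.
rewrite Dq in le_n ge_n.
have h3 : (2 * s * (2 * s * m + n + (s + 8 * m + 8)) < 2 * ((s + 8 * m + 8) * n))%N.
  have le4 : ((t * (8 * m + 8)) <= 2 * n * (8 * m + 8))%N.
    by rewrite leq_mul2r; lia.
  have Dt : (t * (8 * m + 8) + (m + 1) * (8 * m + 8) = q * (8 * m + 8))%N.
    by rewrite Dq; lia.
  lia.
have le4 : (c * m * 2 <= q * m)%N by rewrite mulnAC leq_mul2r mulnC c2 orbT.
have h1 : (2 * s <= c)%N by lia.
have h2 : (sf + n.*2 <= q + 2)%N by lia.
move=> /(_ h1 h2 h3) leN.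
have le5 : (2 * (s * N) <= q * s + q * (9 * m + 9))%N by lia.
have le6 : (q <= s * (s + 2))%N by lia.
have le7 : (q * (9 * m + 9) <= s * (s + 2) * (9 * m + 9))%N.
  by rewrite leq_mul2r le6 orbT.
have le8 : (s * (2 * N) <= s * (q + (s + 2) * (9 * m + 9)))%N by lia.
have le9 : (2 * N <= q + (s + 2) * (9 * m + 9))%N.
  by move: le8; rewrite leq_pmul2l //; lia.
have le10 : (9 * m + 9 <= s * (9 * m + 9))%N by apply: leq_pmull; lia.
lia.
Qed.

(** * The number of points where [f] takes nonzero square values *)

Section StepanovCount.
Variables (F : finFieldType) (f : {poly F}) (m : nat).
Local Notation q := #|F|.
Local Notation c := (#|F|./2).
Hypotheses (q_odd : odd q) (nsf : nonsquare_poly f).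
Hypothesis size_f : (size f <= m.+1)%N.

(** Each term of [stepanov_binom] has [l] factors of degree at most [m], so the large exponent [c]
    does not enter the bound. This keeps the number of linear conditions small. *)
Lemma sizeY_stepanov_expansion b n l J (r s : nat -> {poly F}) :
  (forall j, (size (r j) <= n)%N) -> (forall j, (size (s j) <= n)%N) ->
  (sizeY (stepanov_expansion f b l J r s) <= l * m + n + J)%N.
Proof.
move=> szr szs; have szf k : (sizeY ((f ^+ k)%:P) <= (k * m).+1)%N.
  by rewrite polyC_exp sizeYX_leq ?sizeYC.
apply: sizeY_sum_leq => j.
apply: (@leq_trans ((l * m + n).+1 + j)%N); last by rewrite addSnnS leq_add2l.
rewrite mulrC addnC; apply: sizeYM_leq; first by rewrite sizeYC size_exp_XsubC.
rewrite leqW //; apply: sizeYD_leq.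
  by apply: sizeYM_leq; rewrite ?sizeY_poly_XaY.
rewrite mulrC; apply: sizeYM_leq; rewrite ?sizeY_poly_XaY //.
apply: sizeY_sum_leq => i; rewrite -mulr_natr -polyC_natr.
have -> : (l * m).+1 = ((l * m) + 1)%N by rewrite addn1.
apply: sizeYM_leq; last by rewrite -polyC_natr sizeYC size_polyC; case: eqP.
have -> : (l * m).+1 = ((l - i) * m + (i * m).+1)%N.
  by rewrite addnS -mulnDl subnK // ltnW.
apply: sizeYM_leq => //; apply: sizeYX_leq; apply: sizeYD_leq.
  by rewrite sizeY_poly_XaY.
by rewrite sizeYN sizeYC.
Qed.

Lemma poly_XaYB (p r : {poly F}) : poly_XaY (p - r) = poly_XaY p - poly_XaY r.
Proof. by rewrite /poly_XaY raddfB /= comp_polyB. Qed.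

Lemma stepanov_expansionB b l J (r s r1 s1 r2 s2 : nat -> {poly F}) :
  (forall j, r j = r1 j - r2 j) -> (forall j, s j = s1 j - s2 j) ->
  stepanov_expansion f b l J r s =
  stepanov_expansion f b l J r1 s1 - stepanov_expansion f b l J r2 s2.
Proof.
move=> rE sE; rewrite /stepanov_expansion -sumrB; apply: eq_bigr => j _.
by rewrite rE sE !poly_XaYB; ring.
Qed.

(** The right side of the hypothesis counts the unknown coefficients of the [r j] and [s j]; the
    left side counts the coefficients of the expansion that have to vanish. *)
Lemma stepanov_solution b n l J :
  (l * (l * m + n + J) < 2 * (J * n))%N ->
  exists r s : nat -> {poly F},
    [/\ forall j, (size (r j) <= n)%N, forall j, (size (s j) <= n)%N,
        exists2 j, (j < J)%N & ~ (r j = 0 /\ s j = 0) &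
        forall k, (k < l)%N -> (stepanov_expansion f b l J r s)`_k = 0].
Proof.
move=> ltBA.
pose A := (bool * 'I_J * 'I_n)%type; pose B := ('I_l * 'I_(l * m + n + J))%type.
(* The boolean selects the family [r] or [s]; indices outside the range give 0. *)
pose ext (e : bool) (u : {ffun A -> F}) (j : nat) : {poly F} :=
  \poly_(i < n) oapp (fun j' => oapp (fun i' => u (e, j', i')) 0 (insub i)) 0
                  (insub j).
have szext e u j : (size (ext e u j) <= n)%N by apply: size_poly.
have extB e u v j : ext e (u - v) j = ext e u j - ext e v j.
  apply/polyP => i; rewrite coefB !coef_poly; case: ifP => _; last by rewrite subrr.
  by case: (insub j) => [j'|]; case: (insub i) => [i'|]; rewrite /= ?subrr ?ffunE.
have [||u nzu uE] := @additive_pigeonhole F A B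
    (fun u ki => (stepanov_expansion f b l J (ext true u) (ext false u))`_(ki.1)`_(ki.2)).
- move=> u v [k i] /=.
  by rewrite (stepanov_expansionB _ _ _ (extB true u v) (extB false u v)) !coefB.
- by rewrite !card_prod !card_ord card_bool -mulnA.
exists (ext true u), (ext false u); split=> //.
- have [[[e j] i] nzuji] : exists a, u a != 0.
    apply/existsP; apply: contraR nzu; rewrite negb_exists => /forallP u0.
    by apply/eqP/ffunP => a; rewrite ffunE; apply/eqP; rewrite -[_ == _]negbK u0.
  exists j => //; have extji : (ext e u j)`_i = u (e, j, i).
    by rewrite coef_poly ltn_ord valK /= valK.
  case=> r0 s0; case/eqP: nzuji; rewrite -extji.
  by case: (e); rewrite ?r0 ?s0 coef0.
- move=> k ltkl; apply/polyP => i; rewrite coef0.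
  have [lti|lei] := ltnP i (l * m + n + J).
    exact: (uE (Ordinal ltkl, Ordinal lti)).
  rewrite nth_default // (leq_trans _ lei) // (leq_trans (max_size_coefXY _ _)) //.
  exact: sizeY_stepanov_expansion.
Qed.

(** The auxiliary polynomial is nonzero by independence and vanishes to order [l] at every counted
    point, so [l] times their number is at most its degree. *)
Lemma stepanov_count_param n l J :
  (l <= c)%N -> (size f + n.*2 <= q + 2)%N ->
  (l * (l * m + n + J) < 2 * (J * n))%N ->
  (l * #|[set x | f.[x] ^+ c == 1%R]| <= q * J + c * m + n)%N.
Proof.
move=> le_lc sz_fn ltBA; set S := [set x | _].
(* Any counted point serves as [b]: independence only asks that [f.[b]] be nonzero. *)
have [->|[b bS]] := set_0Vmem S; first by rewrite cards0 muln0.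
have c_gt0 : (0 < c)%N by have := finNzRing_gt1 F; move: q_odd; case: #|F| => [|[|[|k]]].
have fb : f.[b] != 0.
  move: bS; rewrite inE; apply: contraL => /eqP ->.
  by rewrite expr0n eqn0Ngt c_gt0 eq_sym oner_eq0.
have [r [s [szr szs [j ltj nz] V0]]] := stepanov_solution b ltBA.
have nzsum : stepanov_sum f b J r s != 0.
  apply/eqP => sum0; apply: nz.
  exact: (stepanov_independent q_odd nsf fb sz_fn szr szs sum0).
have dvdS x : x \in S -> ('X - x%:P) ^+ l %| stepanov_sum f b J r s.
  by rewrite inE => /eqP fx1; apply: stepanov_sum_vanish.
rewrite -ltnS (leq_trans (dvdp_prod_XsubC_exp nzsum dvdS)) // leqW //.
rewrite (leq_trans (size_sum _ _ _)) //; apply/bigmax_leqP => i _.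
rewrite (leq_trans (size_polyMleq _ _)) // -exprM size_exp_XsubC addnS /=.
have szrs : (size (r i + s i * f ^+ c)%R <= n + c * m)%N.
  rewrite (leq_trans (size_polyD _ _)) // geq_max (leq_trans (szr i)) ?leq_addr //=.
  rewrite (leq_trans (size_polyMleq _ _)) //.
  have: (size (f ^+ c) <= (c * m).+1)%N.
    rewrite (leq_trans (size_poly_exp_leq _ _)) // ltnS mulnC leq_mul2l.
    move: size_f; case: (size f) => [|k] /=; rewrite ?leq0n ?orbT // ltnS => ->.
    by rewrite orbT.
  move=> szf; rewrite -subn1 leq_subLR addnCA add1n; exact: leq_add.
have: (q * i <= q * J)%N by rewrite leq_mul2l ltnW ?orbT.
by move=> leqJ; rewrite addnC -addnA [X in (_ <= _ + X)%N]addnC leq_add.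
Qed.

Lemma stepanov_count s :
  (s * s <= q)%N -> (q < s.+1 * s.+1)%N ->
  (2 * #|[set x | f.[x] ^+ c == 1%R]| <= q + s * (27 * m + 27))%N.
Proof.
move=> le_sq lt_qs; set N := #|_|.
(* For small [s] the trivial bound [N <= q] is enough, as [q <= s (s + 2) <= s (27 m + 27)]. *)
have [small|large] := ltnP s (8 * m + 9).
  have : (N <= q)%N by apply: max_card.
  by move: lt_qs small; clear; move: N #|F| => N q; nia.
have s_gt0 : (0 < s)%N by lia.
have e : exists2 n, (n.*2 <= q - m)%N & (q - m <= n.*2.+1)%N.
  by exists ((q - m)./2); have := odd_double_half (q - m); case: odd => /=; lia.
have [n le_n ge_n] := e.
have c2 : (2 * c <= q)%N by lia.
have c2' : (q <= 2 * c + 1)%N by lia.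
have /= := @stepanov_count_param n (2 * s) (s + 8 * m + 8).
rewrite -/N; move: (size f) N size_f c2 c2' => sf N.
move: c le_sq lt_qs le_n ge_n => c; move: #|F| => q.
clear -large s_gt0 => le_sq lt_qs le_n ge_n le_sf c2 c2'.
exact: stepanov_arith.
Qed.
End StepanovCount.

(** * Odd irreducible factors and specialization *)

Section SquareClass.
Variable F : fieldType.
Implicit Types p r s u w : {poly F}.

Definition scaled_square p : Prop := exists (c : F) r, p = c *: r ^+ 2.

Lemma irreducible_factor p : (1 < size p)%N ->
  exists2 r, irreducible_poly r & r %| p.
Proof.
have [n] := ubnP (size p); elim: n p => // n IHn p ltpn p_gt1.
have [irr_p|] := pselect (irreducible_poly p); first by exists p; rewrite ?dvdpp.
move=> nirr; have [r [r1 dvdr neq]] :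
    exists r, [/\ size r != 1%N, r %| p & ~~ (r %= p)].
  apply: contrapT => H; apply: nirr; split=> // r r1 dvdr.
  by apply: contrapT => /negP neq; apply: H; exists r.
have p0 : p != 0 by rewrite -size_poly_gt0 ltnW.
have r0 : r != 0 by apply: contraNneq p0 => r0; move: dvdr; rewrite r0 dvd0p.
have ltrp : (size r < size p)%N.
  rewrite ltn_neqAle dvdp_leq // andbT; apply: contra neq => /eqP eqs.
  by rewrite -(dvdp_size_eqp dvdr) eqs.
have [||t irrt dvdt] := IHn r; first by lia.
  by move: r0 r1; rewrite -size_poly_gt0; case: (size r) => [|[|k]].
by exists t => //; apply: dvdp_trans dvdt dvdr.
Qed.

Lemma irreducible_dvdpM (r u w : {poly F}) :
  irreducible_poly r -> r %| u * w -> ~~ (r %| u) -> r %| w.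
Proof.
move=> irr dvd ndvd; rewrite -(@Gauss_dvdpr _ w u r) //.
by rewrite irreducible_poly_coprime.
Qed.

(** An irreducible factor that divides [p] only once will do. Otherwise its square is moved into
    [s], and the quotient is smaller and still not a scaled square. *)
Lemma odd_irreducible_factor p : ~ scaled_square p ->
  exists r u s, [/\ irreducible_poly r, p = r * u * s ^+ 2 & ~~ (r %| u)].
Proof.
have [n] := ubnP (size p); elim: n p => // n IHn p ltpn nsq.
have p0 : p != 0.
  by apply/eqP => p0; apply: nsq; exists 0, 0; rewrite p0 scale0r.
have p_gt1 : (1 < size p)%N.
  rewrite ltnNge; apply/negP => /size1_polyC Dp; apply: nsq.
  by exists p`_0, 1; rewrite expr1n alg_polyC.
have [r irr_r /dvdpP[p1 Dp]] := irreducible_factor p_gt1.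
have [/dvdpP[p2 Dp1]|ndvd] := boolP (r %| p1); last first.
  by exists r, p1, 1; rewrite expr1n mulr1 mulrC.
have Dp' : p = p2 * r ^+ 2 by rewrite Dp Dp1 -mulrA.
have r0 := irredp_neq0 irr_r.
have p20 : p2 != 0 by apply: contraNneq p0 => p20; rewrite Dp' p20 mul0r.
have [||r' [u [s [irr' Dp2 ndvd]]]] := IHn p2.
- rewrite Dp' size_mul ?expf_neq0 // in ltpn.
  have := irr_r.1; have : (size r <= size (r ^+ 2))%N.
    by apply: dvdp_leq; rewrite ?expf_neq0 // expr2 dvdp_mulr.
  by move: (size (r ^+ 2)) (size r) (size p2) ltpn; clear; lia.
- case=> c [s Dp2]; apply: nsq; exists c, (s * r).
  by rewrite Dp' Dp2 exprMn -scalerAl.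
by exists r', u, (s * r); rewrite Dp' Dp2 exprMn !mulrA.
Qed.

(** Infinite descent: in [r w s^2 = c t^2] the prime [r] divides [t], then [s], and cancelling [r^2]
    gives the same equation with a smaller [s]. *)
Lemma odd_irreducible_nonsquare (r w : {poly F}) :
  irreducible_poly r -> ~~ (r %| w) -> nonsquare_poly (r * w).
Proof.
move=> irr ndvd s t c; have r0 := irredp_neq0 irr.
have sqr_dvd x : r %| x ^+ 2 -> r %| x.
  move=> dvdx; have [//|nx] := boolP (r %| x).
  by case/negP: (nx); apply: (irreducible_dvdpM irr _ nx); rewrite -expr2.
have [n] := ubnP (size s); elim: n s t => // n IHn s t lts eq_st.
apply/eqP; apply: contraT => s0.
have c0 : c != 0.
  apply: contraNneq (s0) => c0; move/eqP: eq_st.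
  rewrite c0 scale0r mulf_eq0 sqrf_eq0 (negPf s0) orbF mulf_eq0 (negPf r0) => /eqP w0.
  by move: ndvd; rewrite w0 dvdp0.
have /sqr_dvd/dvdpP[t1 Dt] : r %| t ^+ 2.
  by rewrite -(dvdpZr _ _ c0) -eq_st -mulrA dvdp_mulr.
have eq1 : w * s ^+ 2 = c *: (r * t1 ^+ 2).
  by apply: (mulfI r0); rewrite mulrA eq_st Dt -!mul_polyC; ring.
have /sqr_dvd/dvdpP[s1 Ds] : r %| s ^+ 2.
  by apply: (irreducible_dvdpM irr) ndvd; rewrite eq1 dvdpZr // dvdp_mulr.
have s10 : s1 = 0.
  apply: IHn (t1) _ _.
    have s10 : s1 != 0 by apply: contraNneq (s0) => s10; rewrite Ds s10 mul0r.
    rewrite Ds size_mul // in lts.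
    by move: (size s1) (size r) lts irr.1; clear; lia.
  apply: (mulfI r0); rewrite -scalerAr -[RHS](_ : w * s ^+ 2 = _) //.
  by rewrite Ds; ring.
by rewrite Ds s10 mul0r eqxx in s0.
Qed.
End SquareClass.

(** * Gauss's lemma for polynomials in two variables *)

Section Bivariate.
Variable F : fieldType.
Implicit Types (p r : {poly F}) (H A B : {poly {poly F}}).

(** An irreducible polynomial in [y] remains prime in two variables. It divides one of the two
    leading coefficients; removing that leading term, a multiple of [r], makes the sum of the sizes
    smaller. *)
Lemma irreducible_polyC_prime r A B C : irreducible_poly r ->
  A * B = r%:P * C ->
  (exists D, A = r%:P * D) \/ (exists D, B = r%:P * D).
Proof.
move=> irr eqAB; have [n] := ubnP (size A + size B).
elim: n => // n IHn in A B C eqAB * => ltn.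
have [->|A0] := eqVneq A 0; first by left; exists 0; rewrite mulr0.
have [->|B0] := eqVneq B 0; first by right; exists 0; rewrite mulr0.
have dvdl : r %| lead_coef A * lead_coef B.
  by rewrite -lead_coefM eqAB lead_coefM lead_coefC dvdp_mulr.
have step (P Q : {poly {poly F}}) :
    P != 0 -> Q != 0 -> P * Q = r%:P * C -> r %| lead_coef P ->
    (size P + size Q < n.+1)%N ->
    (exists D, P = r%:P * D) \/ (exists D, Q = r%:P * D).
  move=> P0 Q0 eqPQ /dvdpP[a Da] ltPQ.
  pose P' := P - (r * a)%:P * 'X^((size P).-1).
  have ltP' : (size P' < size P)%N.
    rewrite -[X in (_ < X)%N](prednK (n := size P)) ?size_poly_gt0 // ltnS.
    apply/leq_sizeP => j; rewrite leq_eqVlt => /predU1P[<-|ltj].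
      by rewrite coefB coefCM coefXn eqxx mulr1 -lead_coefE Da mulrC subrr.
    rewrite coefB coefCM coefXn gtn_eqF // mulr0 subr0 nth_default //.
    by move: ltj; case: (size P).
  have eqP'Q : P' * Q = r%:P * (C - a%:P * 'X^((size P).-1) * Q).
    by rewrite /P' mulrBl eqPQ polyCM; ring.
  have [|[D DP']|] := IHn _ _ _ eqP'Q; [lia | | by right].
  left; exists (D + a%:P * 'X^((size P).-1)).
  by rewrite mulrDr -DP' /P' polyCM mulrA subrK.
have [dvdA|ndvd] := boolP (r %| lead_coef A); first exact: step.
have dvdB : r %| lead_coef B by apply: irreducible_dvdpM ndvd.
have eqBA : B * A = r%:P * C by rewrite mulrC.
have ltnBA : (size B + size A < n.+1)%N by rewrite addnC.
by have [] := step B A B0 A0 eqBA dvdB ltnBA; [right | left].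
Qed.
End Bivariate.

Section Specialization.
Variable F : fieldType.
Implicit Types (p r : {poly F}) (H A B P : {poly {poly F}}) (t : F).

(** Newton interpolation at constants: [P] is a multiple of ['X - t%:P%:P] plus a multiple of [p],
    and at the other points the differences [u - t] are units, so the cofactor inherits the
    hypothesis. *)
Lemma dvd_polyC_evals p P (ts : seq F) :
  uniq ts -> (size P <= size ts)%N ->
  (forall t, t \in ts -> p %| P.[t%:P]) -> exists A, P = p%:P * A.
Proof.
elim: ts P => [|t ts IHts] P /=.
  by move=> _; rewrite leqn0 size_poly_eq0 => /eqP-> _; exists 0; rewrite mulr0.
case/andP=> tts uts szP dvdP.
have /dvdpP[a Da] : p %| P.[t%:P] by apply: dvdP; rewrite mem_head.
have /factor_theorem[Q DQ] : root (P - (a * p)%:P) t%:P.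
  by rewrite rootE !hornerE Da subrr.
have DP : P = Q * ('X - t%:P%:P) + (a * p)%:P by rewrite -DQ subrK.
have [||A DA] := IHts Q uts.
- have [->|Q0] := eqVneq Q 0; first by rewrite size_poly0.
  rewrite -ltnS (leq_trans _ szP) // DP size_polyDl.
    by rewrite size_Mmonic ?monicXsubC // size_XsubC addn2.
  rewrite size_Mmonic ?monicXsubC // size_XsubC addn2 size_polyC /=.
  by rewrite -size_poly_gt0 in Q0; case: (_ != 0); rewrite ?ltnS.
- move=> u uts'; have : p %| P.[u%:P] by apply: dvdP; rewrite inE uts' orbT.
  have -> : P.[u%:P] = (u - t) *: Q.[u%:P] + a * p.
    rewrite DP hornerD hornerM hornerXsubC hornerC -mul_polyC polyCB; ring.
  rewrite dvdp_addl ?dvdp_mull // dvdpZr //.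
  by rewrite subr_eq0; apply: contraNneq tts => <-.
exists (A * ('X - t%:P%:P) + a%:P).
by rewrite DP DA polyCM; ring.
Qed.

(** An irreducible factor [r] of [L] divides [P], so [r^2] divides the product of [L] and [H]. As
    [r] does not divide [H], all of [r^2] comes from [L] and can be cancelled. *)
Lemma gauss_scaled_square (L : {poly F}) H P :
  L != 0 -> (forall p A, H = p%:P * A -> (size p <= 1)%N) ->
  L%:P * H = P ^+ 2 -> exists (c : F) A, H = c%:P%:P * A ^+ 2.
Proof.
move=> L0 primH; have [n] := ubnP (size L); elim: n => // n IHn in L P L0 *.
move=> ltL eqLH; have [szL|L_gt1] := leqP (size L) 1.
  have [c Dc] : exists c : F, L = c%:P by exists L`_0; apply: size1_polyC.
  have c0 : c != 0 by rewrite -polyC_eq0 -Dc.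
  exists c^-1, P; rewrite -eqLH Dc mulrA -!polyCM mulVf // mul1r //.
have [r irr_r /dvdpP[L1 DL]] := irreducible_factor L_gt1.
have r0 := irredp_neq0 irr_r.
have rC0 : r%:P != 0 :> {poly {poly F}} by rewrite polyC_eq0.
have nH A : H <> r%:P * A by move=> /primH; rewrite leqNgt irr_r.1.
have dvdP : exists P1, P = r%:P * P1.
  have : P * P = r%:P * (L1%:P * H) by rewrite -expr2 -eqLH DL polyCM; ring.
  by case/(irreducible_polyC_prime irr_r).
have [P1 DP1] := dvdP.
have eq1 : L1%:P * H = r%:P * P1 ^+ 2.
  apply: (mulfI rC0); transitivity (L%:P * H); first by rewrite DL polyCM; ring.
  by rewrite eqLH DP1; ring.
case/(irreducible_polyC_prime irr_r): (eq1) => [[A DA]|[A /nH]//].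
have dvdL1 : r %| L1.
  have := congr1 (fun B => B`_0) DA; rewrite coefC coefCM eqxx => ->.
  exact: dvdp_mulr.
have [L2 DL2] := dvdpP _ _ dvdL1.
have L20 : L2 != 0.
  by apply: contraNneq L0 => L20; rewrite DL DL2 L20 !mul0r.
apply: (IHn L2 P1) => //.
  move: ltL; rewrite DL DL2 !size_mul ?mulf_neq0 //.
  by move: (size L2) (size r) irr_r.1; clear; lia.
by apply: (mulfI rC0); rewrite -eq1 DL2 polyCM; ring.
Qed.

(** Admissibility speaks about every primitive kernel, so it yields information only once a kernel
    is at hand. Splitting off one-variable factors lowers the sum of the two degrees. *)
Lemma primitive_kernel_exists (f : {poly {poly F}}) :
  f != 0 -> exists H, primitive_kernel f H.
Proof.
have [n] := ubnP (size f + sizeY f); elim: n f => // n IHn f ltf f0.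
have [primf|] := pselect (primitive_xy f).
  by exists f; split=> //; exists 1, 1; rewrite rmorph1 !mul1r.
move=> /not_andP[|] /existsNP[p /existsNP[g /not_implyP[Df /negP]]].
  rewrite -ltnNge => szp.
  have g0 : g != 0 by apply: contraNneq f0 => g0; rewrite Df g0 mulr0.
  have p0 : p != 0 by rewrite -size_poly_gt0 ltnW.
  have [|H [primH [Fx [Gy Dg]]]] := IHn g _ g0.
    move: ltf; rewrite Df !sizeYE rmorphM /= swapXY_map_polyC.
    rewrite !size_mul ?map_polyC_eq0 ?polyC_eq0 ?swapXY_eq0 //.
    rewrite size_map_polyC size_polyC p0.
    by move: (size g) (size (swapXY g)) (size p) szp; clear; lia.
  exists H; split=> //; exists (p * Fx), Gy.
  by rewrite Df Dg rmorphM /= !mulrA.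
rewrite -ltnNge => szp.
have g0 : g != 0 by apply: contraNneq f0 => g0; rewrite Df g0 mulr0.
have p0 : p != 0 by rewrite -size_poly_gt0 ltnW.
have [|H [primH [Fx [Gy Dg]]]] := IHn g _ g0.
  move: ltf; rewrite Df !sizeYE rmorphM /= swapXY_polyC.
  rewrite !size_mul ?map_polyC_eq0 ?polyC_eq0 ?swapXY_eq0 //.
  rewrite size_map_polyC size_polyC p0.
  by move: (size g) (size (swapXY g)) (size p) szp; clear; lia.
exists H; split=> //; exists Fx, (p * Gy).
by rewrite Df Dg polyCM; ring.
Qed.

(** * Approximate square roots and specializations that are squares *)

Section PseudoSqrt.
Hypothesis two_neq0 : 2 != 0 :> F.

(** The square is completed one coefficient at a time, from the top. Each round multiplies by twice
    the leading coefficient of [S] instead of dividing by it; this triples the bound on the degrees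
    in [y] and removes one more power of [x] from [R]. After [m] rounds the factor is [3 ^ m]. *)
Lemma pseudo_sqrt H m b :
  size H = m.*2.+1 -> (sizeY H <= b.+1)%N ->
  exists (L : {poly F}) (S R : {poly {poly F}}),
   [/\ L != 0, L%:P * H = S ^+ 2 + R, size S = m.+1, (size R <= m)%N &
       (size L <= (3 ^ m * (b + b)).+1)%N /\ (sizeY R <= (3 ^ m * (b + b)).+1)%N].
Proof.
move=> szH szYH.
have two0 : 2 != 0 :> {poly F} by rewrite -polyC_natr polyC_eq0.
suff /(_ m (leqnn m)) [L [S [R [L0 eqLH szS szR [szL _ szYR]]]]] :
    forall k, (k <= m)%N -> exists (L : {poly F}) (S R : {poly {poly F}}),
   [/\ L != 0, L%:P * H = S ^+ 2 + R, size S = m.+1, (size R <= m.*2 - k)%N &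
   [/\ (size L <= (3 ^ k * (b + b)).+1)%N, (sizeY S <= (3 ^ k * (b + b)).+1)%N &
       (sizeY R <= (3 ^ k * (b + b)).+1)%N]].
  by exists L, S, R; split=> //; move: szR; rewrite -addnn addnK.
elim=> [_|k IHk ltkm].
  pose l := lead_coef H.
  have l0 : l != 0 by rewrite lead_coef_eq0 -size_poly_eq0 szH.
  have szl : (size l <= b.+1)%N by apply: leq_trans (max_size_lead_coefXY _) szYH.
  have sz1 : size (l%:P * 'X^m) = m.+1.
    by rewrite size_Cmul ?size_polyXn.
  have Yl : (sizeY (l%:P * 'X^m) <= b.+1)%N.
    rewrite -[b.+1]addn1; apply: sizeYM_leq; rewrite ?sizeYC // sizeYE.
    by rewrite rmorphXn /= swapXY_X -polyC_exp size_polyC; case: eqP.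
  (* Multiplication by the leading coefficient of [H] turns the top coefficient into the square
     [l ^+ 2]. *)
  exists l, (l%:P * 'X^m), (l%:P * H - (l%:P * 'X^m) ^+ 2); split=> //.
  - by rewrite addrC subrK.
  - rewrite subn0; apply/leq_sizeP => j; rewrite leq_eqVlt => /predU1P[<-|ltj].
      rewrite exprMn -exprM -polyC_exp coefB !coefCM coefXn muln2 eqxx mulr1.
      by rewrite expr2 [H`__](_ : _ = l) ?subrr // /l lead_coefE szH.
    rewrite exprMn -exprM -polyC_exp coefB !coefCM coefXn muln2 gtn_eqF //.
    by rewrite mulr0 subr0 nth_default ?mulr0 // szH.
  rewrite expn0 mul1n; split.
  - by rewrite (leq_trans szl) // ltnS leq_addr.
  - by rewrite (leq_trans Yl) // ltnS leq_addr.
  apply: sizeYD_leq.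
    by rewrite -addnS; apply: sizeYM_leq; rewrite ?sizeYC.
  by rewrite sizeYN expr2 -addnS; apply: sizeYM_leq.
have [L [S [R [L0 eqLH szS szR [Le Se Re]]]]] := IHk (ltnW ltkm).
rewrite expnS -mulnA; set e := (3 ^ k * (b + b))%N in Le Se Re *.
pose d := (m - k.+1)%N; pose l := lead_coef S; pose r := R`_(m + d).
have ltdm : (d < m)%N by rewrite /d; lia.
have l0 : l != 0 by rewrite lead_coef_eq0 -size_poly_eq0 szS.
have lE : S`_m = l by rewrite /l lead_coefE szS.
have sz2 : (size (2%R : {poly F}) <= 1)%N by rewrite -polyC_natr size_polyC; case: eqP.
have szM (p q : {poly F}) i j : (size p <= i.+1)%N -> (size q <= j.+1)%N ->
    (size (p * q)%R <= (i + j).+1)%N.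
  move=> szp szq; rewrite (leq_trans (size_polyMleq _ _)) //.
  by move: (size p) (size q) szp szq; clear; lia.
have le : (size l <= e.+1)%N by apply: leq_trans (max_size_lead_coefXY _) Se.
have re : (size r <= e.+1)%N by apply: leq_trans (max_size_coefXY _ _) Re.
have l2e : (size (2 * l)%R <= e.+1)%N by apply: (szM _ _ 0).
have YX i : (sizeY ('X^i : {poly {poly F}}) <= 1)%N.
  by rewrite sizeYE rmorphXn /= swapXY_X -polyC_exp size_polyC; case: eqP.
have YM (A B : {poly {poly F}}) i j : (sizeY A <= i.+1)%N -> (sizeY B <= j.+1)%N ->
    (sizeY (A * B)%R <= (i + j).+1)%N.
  by rewrite -addnS; apply: sizeYM_leq.
(* The new square exceeds [(2 l)^2 S^2] by [4 l r S x^d + r^2 x^(2d)]. As [d < m], its coefficient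
   at [x^(m+d)] is [4 l^2 r], which cancels the top coefficient of [(2 l)^2 R]. *)
exists ((2 * l) ^+ 2 * L), ((2 * l)%:P * S + r%:P * 'X^d),
  (((2 * l) ^+ 2)%:P * R - (2 * (2 * l) * r)%:P * S * 'X^d - (r ^+ 2)%:P * 'X^(d + d)).
have szS1 : size ((2 * l)%:P * S) = m.+1 by rewrite size_Cmul ?mulf_neq0.
have szX1 : (size (r%:P * 'X^d)%R < m.+1)%N.
  rewrite (leq_ltn_trans (size_polyMleq _ _)) // size_polyXn addnS /= size_polyC.
  by case: (r != 0) => /=; lia.
split.
- by rewrite mulf_neq0 // expf_neq0 // mulf_neq0.
- rewrite [X in X * H]polyCM -[LHS]mulrA eqLH exprD; set y := 'X^d.
  by rewrite !(polyCM, polyC_exp); ring.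
- by rewrite size_polyDl szS1.
- apply/leq_sizeP => j lej; rewrite !coefB !(coefCM, coefMXn) coefXn.
  have jE : (m.*2 - k.+1 = m + d)%N by rewrite /d; lia.
  rewrite jE leq_eqVlt in lej; case/predU1P: lej => [<-|ltj].
    rewrite -/r ltnNge leq_addl addnK /= lE.
    have -> : (m + d == d + d)%N = false by rewrite eqn_add2r; lia.
    by rewrite mulr0 subr0; ring.
  have -> : (j == d + d)%N = false by apply/negP => /eqP; lia.
  have -> : (j < d)%N = false by apply/negP; lia.
  rewrite [R`_j]nth_default; last by rewrite (leq_trans szR) //; lia.
  by rewrite [S`__]nth_default ?szS ?mulr0 ?subrr //; lia.
split.
- have -> : (3 * e = (e + e) + e)%N by lia.
  by apply: (szM) => //; rewrite expr2; apply: (szM).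
- rewrite (@leq_trans (e + e).+1) //; last by rewrite ltnS; lia.
  apply: sizeYD_leq; apply: (YM); rewrite ?sizeYC //.
  by rewrite (leq_trans (YX _)).
have -> : (3 * e = (e + e) + e)%N by lia.
apply: sizeYD_leq; [apply: sizeYD_leq|]; rewrite ?sizeYN.
- by apply: (YM) => //; rewrite sizeYC expr2; apply: (szM).
- rewrite -[(e + e + e)%N]addn0; apply: (YM) => //; apply: (YM) => //.
  by rewrite sizeYC; apply: (szM) => //; apply: (szM _ _ 0).
- rewrite -[(e + e + e)%N]addn0; apply: (YM) => //; rewrite sizeYC expr2.
  by rewrite (leq_trans (szM _ _ _ _ re re)) // ltnS leq_addr.
Qed.
End PseudoSqrt.
End Specialization.

Lemma coef_sqr_top (F : comNzRingType) (A : {poly F}) m :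
  (size A <= m.+1)%N -> (A ^+ 2)`_(m + m) = A`_m ^+ 2.
Proof.
move=> szA; rewrite expr2 coefM; pose j0 : 'I_(m + m).+1 := inord m.
have j0E : j0 = m :> nat by rewrite inordK // ltnS leq_addr.
rewrite (bigD1 j0) //= j0E addnK big1 ?addr0 -?expr2 // => j neq.
have : (m < j)%N || (m < m + m - j)%N.
  by move: neq; rewrite -val_eqE /= j0E; case: j => j /= _; clear; lia.
case/orP => ltm.
  by rewrite [A`_j]nth_default ?mul0r // (leq_trans szA).
by rewrite [A`_(_ - _)]nth_default ?mulr0 // (leq_trans szA).
Qed.

(** With [L H = S^2 + R] from [pseudo_sqrt], a specialization [c r^2] of [H] makes [R] specialize to
    a difference of two squares. That is too small in degree unless a leading coefficient or [L]
    vanishes at [t]. *)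
Lemma square_locus (F : fieldType) (H : {poly {poly F}}) (d : nat) :
  2 != 0 :> F -> primitive_xy H ->
  ~ (exists (c : F) P, H = c%:P%:P * P ^+ 2) ->
  (size H <= d.+1)%N -> (sizeY H <= d.+1)%N ->
  exists e : {poly F}, [/\ e != 0, (size e <= (d + 2 * (3 ^ d * (d + d))).+1)%N &
    forall t, scaled_square (map_poly (horner_eval t) H) -> root e t].
Proof.
move=> two0 [_ primH] nsqH szH szYH.
have H0 : H != 0.
  by apply/eqP => H0; apply: nsqH; exists 0, 0; rewrite H0 expr0n mulr0.
pose l := lead_coef H; have l0 : l != 0 by rewrite lead_coef_eq0.
have szl : (size l <= d.+1)%N by apply: leq_trans (max_size_lead_coefXY _) szYH.
pose ev t : {poly {poly F}} -> {poly F} := map_poly (horner_eval t).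
have sz_ev t : l.[t] != 0 -> size (ev t H) = size H.
  by move=> lt0; apply: size_map_poly_id0.
have sz_sqr (c : F) (r : {poly F}) : c *: r ^+ 2 != 0 ->
    size (c *: r ^+ 2) = (size r).-1.*2.+1.
  move=> nz; have c0 : c != 0 by apply: contraNneq nz => ->; rewrite scale0r.
  have r0 : r != 0 by apply: contraNneq nz => ->; rewrite expr0n scaler0.
  by rewrite size_scale // -muln2 -size_exp prednK // size_poly_gt0 expf_neq0.
have ev_neq0 t : l.[t] != 0 -> ev t H != 0.
  by move=> lt0; rewrite -size_poly_eq0 sz_ev // size_poly_eq0.
(* An even size means an odd degree in [x], and a scaled square has even degree; so [l] must vanish
   at [t]. *)
have [oddH|evenH] := boolP (odd (size H)); last first.
  exists l; split=> //; first by rewrite (leq_trans szl) // ltnS leq_addr.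
  move=> t [c [r]]; rewrite -/(ev t H) => Dr; rewrite rootE; apply: contraNT evenH => lt0.
  by rewrite -(sz_ev _ lt0) Dr sz_sqr -?Dr ?ev_neq0 //= odd_double.
have [m Dm] : exists m, size H = m.*2.+1.
  by exists (size H)./2; rewrite -[LHS]odd_double_half oddH.
have le_md : (m <= d)%N by lia.
have [L [S [R [L0 eqLH szS szR [szL szYR]]]]] := pseudo_sqrt two0 Dm szYH.
have R0 : R != 0.
  apply/eqP => R0; apply: nsqH; apply: (gauss_scaled_square L0 primH (P := S)).
  by rewrite eqLH R0 addr0.
(* Outside the roots of [e] the specialization keeps the degree of [H] and keeps [L] and [R]
   nonzero. *)
pose e := l * L * lead_coef R; have e0 : e != 0 by rewrite !mulf_neq0 // lead_coef_eq0.
exists e; split=> //.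
  have le3 : (3 ^ m * (d + d) <= 3 ^ d * (d + d))%N.
    by rewrite leq_mul2r leq_exp2l ?le_md ?orbT.
  rewrite (leq_trans (size_polyMleq _ _)) //.
  have := size_polyMleq l L; have := leq_trans (max_size_lead_coefXY R) szYR.
  by move: (size (l * L)) (size (lead_coef R)) (size l) (size L) szl szL le3; clear; lia.
move=> t [c [r]]; rewrite -/(ev t H) => Dr; rewrite !rootM; apply: contraT.
rewrite !negb_or => /andP[/andP[lt0 Lt0] Rt0].
have evH0 := ev_neq0 _ lt0.
have szr : size r = m.+1.
  have := sz_ev _ lt0; rewrite Dr sz_sqr -?Dr // Dm => /succn_inj/double_inj.
  have : size r != 0%N.
    rewrite size_poly_eq0; apply: contraNneq evH0 => r0.
    by rewrite Dr r0 expr0n scaler0.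
  by case: (size r) => [|k] //= _ ->.
have r0 : r != 0 by rewrite -size_poly_eq0 szr.
have eq_ev : (L.[t] * c) *: r ^+ 2 = ev t S ^+ 2 + ev t R.
  rewrite /ev -rmorphXn -rmorphD -eqLH rmorphM /= map_polyC /= -/(ev t H) Dr.
  by rewrite -scalerA mul_polyC.
have szRt : (size (ev t R) <= m)%N by apply: leq_trans (size_poly _ _) szR.
have szSt : (size (ev t S) <= m.+1)%N by rewrite -szS; apply: size_poly.
pose lr := r`_m; pose lS := (ev t S)`_m.
have lr0 : lr != 0 by rewrite -[lr](_ : lead_coef r = _) ?lead_coef_eq0 // lead_coefE szr.
have eq_top : L.[t] * c * lr ^+ 2 = lS ^+ 2.
  have := congr1 (fun A : {poly F} => A`_(m + m)) eq_ev.
  rewrite coefZ coefD !coef_sqr_top ?szr // [(ev t R)`__]nth_default ?addr0 //.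
  exact: leq_trans szRt (leq_addr _ _).
pose a := lS / lr.
have Da : L.[t] * c = a ^+ 2.
  by rewrite /a expr_div_n -eq_top mulfK // expf_neq0.
have Lc0 : L.[t] * c != 0.
  rewrite mulf_neq0 //; apply: contraNneq evH0 => c0.
  by rewrite Dr c0 scale0r.
have a0 : a != 0 by apply: contraNneq Lc0 => a0; rewrite Da a0 expr0n.
have facR : ev t R = (a *: r - ev t S) * (a *: r + ev t S).
  have -> : ev t R = (L.[t] * c) *: r ^+ 2 - ev t S ^+ 2 by rewrite eq_ev addrC addKr.
  by rewrite Da -!mul_polyC polyC_exp; ring.
have evR0 : ev t R != 0.
  apply: contraNneq Rt0 => evR; rewrite rootE lead_coefE.
  have := congr1 (fun A : {poly F} => A`_(size R).-1) evR.
  by rewrite coef_map coef0 => /eqP.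
move: evR0 szRt; rewrite facR mulf_eq0 negb_or => /andP[n1 n2].
rewrite size_mul //.
(* The two factors add up to [2 a r], of degree [m], so one of them has degree at least [m]; but
   their product, nonzero, has degree below [m]. *)
have sum_sz : (m < maxn (size (a *: r - ev t S)%R) (size (a *: r + ev t S)%R))%N.
  apply: (leq_trans _ (size_polyD _ _)).
  have -> : a *: r - ev t S + (a *: r + ev t S) = (a *+ 2) *: r.
    by rewrite -!mul_polyC polyCMn; ring.
  by rewrite size_scale ?szr // -mulr_natr mulf_neq0.
rewrite -!size_poly_gt0 in n1 n2.
move: n1 n2 sum_sz; set u := a *: r - _; set v := a *: r + _.
by move: (size u) (size v); clear; lia.
Qed.

Lemma card_root (F : finFieldType) (p : {poly F}) :
  p != 0 -> (#|[set t | root p t]| < size p)%N.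
Proof.
move=> p0; rewrite cardE; apply: max_poly_roots; rewrite ?enum_uniq //.
by apply/allP => t; rewrite mem_enum inE.
Qed.

Lemma eval_map_horner (F : comNzRingType) (f : {poly {poly F}}) (x t : F) :
  (map_poly (horner_eval t) f).[x] = f.[x, t].
Proof. by have := horner_map (horner_eval t) f x%:P; rewrite /= /horner_eval hornerC. Qed.

Lemma map_horner_map_polyC (F : comNzRingType) (p : {poly F}) (t : F) :
  map_poly (horner_eval t) p^:P = p.
Proof. by apply/polyP => i; rewrite !coef_map /= /horner_eval hornerC. Qed.

(** * Pairs of columns whose product is not a scaled square *)

Section Generic.
Variables (F : finFieldType) (f : {poly {poly F}}) (d : nat).
Hypotheses (q_odd : odd #|F|) (adm_f : admissible f) (f0 : f != 0).
Hypotheses (szf : (size f <= d.+1)%N) (szYf : (sizeY f <= d.+1)%N).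
Local Notation ft t := (map_poly (horner_eval t) f).

Lemma odd_card_two_neq0 : 2 != 0 :> F.
Proof.
have [p pr_p chF] := finPcharP F.
apply/negP => /eqP two0; have ch2 : 2%N \in [pchar F] by rewrite inE /= two0 eqxx.
have := card_primeChar ch2 => cardF; move: q_odd; rewrite cardF oddX orbF => /eqP n0.
by have := finNzRing_gt1 F; rewrite cardF n0.
Qed.

(** The product of two specializations of [f = F(x) G(y) H] is [F^2 G(t) G(u) H(x,t) H(x,u)]. Roots
    of [G] are put into both exceptional sets, and the square [F^2] is harmless, so only [H]
    matters. *)
Lemma generic_nonsquare_pairs :
  exists2 E : {set F}, (#|E| <= d + (d + 2 * (3 ^ d * (d + d))))%N &
    forall t, t \notin E -> exists2 B : {set F}, (#|B| <= d + d)%N &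
      forall u, u \notin B -> nonsquare_poly (ft t * ft u).
Proof.
have [H kerH] := primitive_kernel_exists f0.
have [primH [Fx [Gy Df]]] := kerH.
have nsqH := adm_f.2 H kerH.
have [[Fx0 Gy0] H0] : (Fx != 0 /\ Gy != 0) /\ H != 0.
  by split; [split|]; apply: contraNneq f0 => z; rewrite Df z ?rmorph0 ?mulr0 ?mul0r.
have FxP0 : Fx^:P != 0 by rewrite map_polyC_eq0.
have GyP0 : Gy%:P != 0 :> {poly {poly F}} by rewrite polyC_eq0.
have szE : size f = (size Fx + (size H)).-1.
  by rewrite Df size_mul ?mulf_neq0 // size_mul // size_map_polyC size_polyC Gy0 addn1.
have szYE : sizeY f = (size Gy + sizeY H).-1.
  rewrite Df !sizeYE !rmorphM /= swapXY_polyC swapXY_map_polyC.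
  rewrite size_mul ?mulf_neq0 ?swapXY_eq0 ?map_polyC_eq0 ?polyC_eq0 //.
  by rewrite size_Cmul // size_map_polyC.
have szFx : (0 < size Fx)%N by rewrite size_poly_gt0.
have szGy : (0 < size Gy)%N by rewrite size_poly_gt0.
have szH0 : (0 < size H)%N by rewrite size_poly_gt0.
have szYH0 : (0 < sizeY H)%N by rewrite lt0n sizeY_eq0.
have szH : (size H <= d.+1)%N by move: szf; rewrite szE; lia.
have szYH : (sizeY H <= d.+1)%N by move: szYf; rewrite szYE; lia.
have szG : (size Gy <= d.+1)%N by move: szYf; rewrite szYE; lia.
have [e [e0 sze rte]] := square_locus odd_card_two_neq0 primH nsqH szH szYH.
have cardG : (#|[set t | root Gy t]| <= d)%N.
  by rewrite -ltnS (leq_trans (card_root Gy0)).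
have cardRe : (#|[set t | root e t]| <= d + 2 * (3 ^ d * (d + d)))%N.
  by rewrite -ltnS (leq_trans (card_root e0)).
exists ([set t | root Gy t] :|: [set t | root e t]).
  by rewrite (leq_trans (leq_card_setU _ _)) // leq_add.
move=> t; rewrite !inE negb_or => /andP[Gt et].
have [|r [w [s [irr_r DHt ndvd]]]] := @odd_irreducible_factor F (map_poly (horner_eval t) H).
  by move=> /rte; rewrite (negPf et).
pose B := [set u | r %| map_poly (horner_eval u) H].
exists ([set u | root Gy u] :|: B).
  rewrite (leq_trans (leq_card_setU _ _)) // leq_add // -ltnS (leq_trans _ szYH) //.
  rewrite ltnNge; apply/negP => leB.
  (* The variables are swapped because [r] is a polynomial in [x] while the evaluations are in [y].
     Too many of them would give [H] the factor [r(x)], against primitivity. *)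
  have [||u|A DA] := @dvd_polyC_evals F r (swapXY H) (enum B).
  - exact: enum_uniq.
  - by rewrite -sizeYE -cardE.
  - by rewrite mem_enum inE horner_swapXY.
  have : H = r^:P * swapXY A by rewrite -[LHS]swapXYK DA rmorphM /= swapXY_polyC.
  by move/primH.1; rewrite leqNgt irr_r.1.
move=> u; rewrite !inE negb_or => /andP[Gu nru].
have Dft v : ft v = Fx * (Gy.[v])%:P * map_poly (horner_eval v) H.
  by rewrite Df !rmorphM /= map_horner_map_polyC map_polyC.
have Ht0 : map_poly (horner_eval t) H != 0.
  apply/negP => /eqP Ht0; move/negP: et; apply; apply: rte.
  by exists 0, 0; rewrite Ht0 scale0r.
have s0 : s != 0 by apply: contraNneq Ht0 => s0; rewrite DHt s0 expr0n mulr0.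
have nonsq : nonsquare_poly (r * (w * map_poly (horner_eval u) H)).
  apply: odd_irreducible_nonsquare => //; apply/negP => dvd.
  by move/negP: nru; apply; apply: (irreducible_dvdpM irr_r dvd).
move=> x y c eqxy.
have G0 : Gy.[t] * Gy.[u] != 0 by rewrite mulf_neq0.
(* The squares [F^2] and [s^2] are absorbed into the multiplier, and [G(t) G(u)] into the
   constant. *)
have : Fx * s * x = 0.
  apply: (nonsq _ y (c / (Gy.[t] * Gy.[u]))).
  apply: (scalerI G0); rewrite [RHS]scalerA [_ * (c / _)]mulrC divfK // -eqxy !Dft DHt.
  by rewrite -mul_polyC polyCM; ring.
by move/eqP; rewrite mulf_eq0 mulf_eq0 (negPf Fx0) (negPf s0) => /eqP.
Qed.
End Generic.

(** * Discrepancy of the graphs *)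

(** The nonzero elements are the powers of a primitive root of order [2 c]; if the [c]-th power of
    [z ^+ k] is 1, then [2 c] divides [k c] and [k] is even. *)
Lemma euler_criterion (F : finFieldType) (u : F) :
  odd #|F| -> u != 0 -> u ^+ #|F|./2 = if is_square u then 1 else -1.
Proof.
move=> q_odd u0; set c := #|F|./2.
have cardF : #|F| = (c * 2).+1 by rewrite muln2 -[LHS]odd_double_half q_odd.
have c_gt0 : (0 < c)%N by have := finNzRing_gt1 F; rewrite cardF; case: (c).
have unit_root (x : F) : x != 0 -> x ^+ (c * 2) = 1.
  by move=> x0; apply: (mulfI x0); rewrite -exprS -cardF expf_card mulr1.
have sq1 : u ^+ c = 1 -> is_square u.
  move=> uc1; pose rs := enum (predC1 (0 : F)).
  have rs_roots : all (c * 2).-unity_root rs.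
    by apply/allP => x; rewrite mem_enum !inE unity_rootE => /unit_root ->.
  have le_rs : (c * 2 <= size rs)%N.
    by rewrite -cardE cardC1 cardF.
  have := has_prim_root _ rs_roots (enum_uniq _) le_rs.
  rewrite muln_gt0 c_gt0 => /(_ isT)/hasP[z _ prim_z].
  have [[k /= _] Du] := prim_rootP prim_z (unit_root u u0).
  have : (c * 2 %| k * c)%N by rewrite (prim_order_dvd prim_z) exprM -Du uc1.
  rewrite [(c * 2)%N]mulnC dvdn_pmul2r // => /dvdnP[j Dk].
  by apply/existsP; exists (z ^+ j); rewrite Du Dk exprM.
case: ifP => [/existsP[z /eqP Du]|nsq].
  have z0 : z != 0 by apply: contraNneq u0 => z0; rewrite Du z0 expr0n.
  by rewrite Du -exprM mulnC unit_root.
have : (u ^+ c) ^+ 2 = 1 by rewrite -exprM unit_root.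
move/eqP; rewrite sqrf_eq1 => /orP[/eqP/sq1|/eqP//].
by rewrite nsq.
Qed.

Definition adj_sign (F : finFieldType) (f : {poly {poly F}}) (x t : F) : int :=
  if Xadj f x t then 1 else -1.

(** An upper bound suffices, because these sums occur only in the expansion of a square that is
    bounded from above. Hence only the points where [g] is a nonzero square are counted. *)
Lemma adj_sign_pair_sum (F : finFieldType) (f : {poly {poly F}}) (m s : nat)
    (t u : F) (g := map_poly (horner_eval t) f * map_poly (horner_eval u) f) :
  odd #|F| -> (s * s <= #|F|)%N -> (#|F| < s.+1 * s.+1)%N ->
  (size g <= m.+1)%N -> nonsquare_poly g ->
  \sum_x adj_sign f x t * adj_sign f x u <= (s * (27 * m + 27) + 2 * (m + 2))%:Z.
Proof.
move=> q_odd le_s lt_s szg nsg.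
pose S1 := [set x | g.[x] ^+ #|F|./2 == 1].
(* Outside [Z] the product of signs is the quadratic character of [g.[x]]. On [Z], which holds the
   zeros and the two diagonal positions, adding 2 covers every possible value. *)
pose Z := [set x | root g x] :|: [set t; u].
have leZ : (#|Z| <= m + 2)%N.
  rewrite (leq_trans (leq_card_setU _ _)) // leq_add //.
    by rewrite -ltnS (leq_trans (card_root (nonsquare_poly_neq0 nsg))).
  by rewrite cards2; case: (_ != _).
have bound x : adj_sign f x t * adj_sign f x u <=
    (x \in S1)%:Z * 2 - 1 + (x \in Z)%:Z * 2.
  have [xZ|] := boolP (x \in Z).
    by rewrite /adj_sign; do 2!case: ifP => _; case: (x \in S1).
  rewrite !inE !negb_or rootE => /andP[gx /andP[xt xu]].
  have : f.[x, t] * f.[x, u] != 0 by rewrite -!eval_map_horner -hornerM.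
  rewrite mulf_eq0 negb_or => /andP[ft0 fu0].
  have -> : (g.[x] ^+ #|F|./2 == 1) = (is_square f.[x, t] == is_square f.[x, u]).
    have two0 := odd_card_two_neq0 q_odd.
    have neg1 : (-1 == 1 :> F) = false.
      by rewrite eq_sym -subr_eq0 opprK; apply/negbTE.
    rewrite hornerM !eval_map_horner exprMn !euler_criterion //.
    by do 2!case: ifP => _; rewrite ?mulr1 ?mul1r ?mulrNN ?mulr1 ?eqxx.
  rewrite /adj_sign /Xadj xt xu /=.
  by case: (is_square _); case: (is_square _).
apply: (le_trans (ler_sum _ (fun x _ => bound x))).
rewrite !big_split /= -!mulr_suml.
have sumE (A : {set F}) : \sum_x (x \in A)%:Z = #|A|%:Z.
  rewrite -[RHS]natz -sum1_card natr_sum [RHS]big_mkcond.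
  by apply: eq_bigr => x _; case: ifP.
have -> : \sum_(x : F) (-1 : int) = - #|F|%:Z by rewrite sumr_const mulNrn natz.
have := stepanov_count q_odd nsg szg le_s lt_s; rewrite -/S1 !sumE.
by move: #|S1| #|Z| #|F| leZ; clear; lia.
Qed.

(** Cauchy-Schwarz over the integers: the sum of all [(a i - a j) ^+ 2] is nonnegative and equals
    twice the difference of the two sides. *)
Lemma sqr_sum_le (I : finType) (A : {set I}) (a : I -> int) :
  (\sum_(i in A) a i) ^+ 2 <= #|A|%:Z * \sum_(i in A) a i ^+ 2.
Proof.
have : 0 <= \sum_(i in A) \sum_(j in A) (a i - a j) ^+ 2.
  by apply: sumr_ge0 => i _; apply: sumr_ge0 => j _; apply: sqr_ge0.
set n := #|A|%:Z; set s := \sum_(i in A) a i; set Q := \sum_(i in A) a i ^+ 2.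
have inner i : \sum_(j in A) (a i - a j) ^+ 2 = a i ^+ 2 * n - a i * (2 * s) + Q.
  rewrite (eq_bigr (fun j => a i ^+ 2 - a i * 2 * a j + a j ^+ 2)).
    rewrite big_split sumrB /= sumr_const -mulr_sumr -[_ *+ #|A|]mulr_natr natz.
    by rewrite -/n -/s -/Q mulrA.
  by move=> j _; ring.
rewrite (eq_bigr _ (fun i _ => inner i)) big_split sumrB /= -!mulr_suml.
rewrite sumr_const -/s -/Q -[_ *+ #|A|]mulr_natr natz -/n => le0.
rewrite -(ler_pM2r (x := 2)) // -subr_ge0; apply: le_trans le0 _.
by rewrite le_eqVlt; apply/orP; left; apply/eqP; ring.
Qed.

Lemma bilinear_sum_bound (I : finType) (eps : I -> I -> int) (E S T : {set I})
    (K1 K2 M : nat) :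
  (forall x t u, eps x t * eps x u <= 1) -> (#|E| <= K1)%N ->
  (forall t, t \notin E -> exists2 B : {set I}, (#|B| <= K2)%N &
     forall u, u \notin B -> \sum_x eps x t * eps x u <= M%:Z) ->
  (\sum_(x in S) \sum_(t in T) eps x t) ^+ 2 <=
    (#|S| * #|T| * (K1 * #|I| + K2 * #|I| + #|I| * M))%:Z.
Proof.
move=> eps1 leE goodE; set q := #|I|.
pose Z t u := \sum_x eps x t * eps x u.
have Zq t u : Z t u <= q%:Z.
  apply: (le_trans (ler_sum _ (fun x _ => eps1 x t u))).
  by rewrite sumr_const natz.
have sum_ind (A C : {set I}) (k : nat) :
    \sum_(x in A) (x \in C)%:Z * k%:Z <= #|C|%:Z * k%:Z.
  rewrite -mulr_suml ler_wpM2r // -[#|C|%:Z]natz -sumr_const big_mkcond.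
  rewrite [leRHS]big_mkcond; apply: ler_sum => x _.
  by case: ifP => _; case: ifP.
have TI : (#|T| <= q)%N by apply: max_card.
(* Rows in [E] get the trivial bound [q] for each entry; any other row has at most [K2] entries
   without the bound [M]. *)
have rowE t : \sum_(u in T) Z t u <= (t \in E)%:Z * (q * #|T|)%:Z + (K2 * q + #|T| * M)%:Z.
  have [tE|tE] := boolP (t \in E).
    apply: (@le_trans _ _ (q * #|T|)%:Z); last by lia.
    apply: (le_trans (ler_sum _ (fun u _ => Zq t u))).
    by rewrite sumr_const -[_ *+ #|T|]mulr_natr natz PoszM.
  have [B leB goodB] := goodE t tE.
  have bnd u : Z t u <= (u \in B)%:Z * q%:Z + M%:Z.
    have [uB|uB] := boolP (u \in B); last by rewrite mul0r add0r goodB.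
    by rewrite mul1r (le_trans (Zq t u)) // lerDl.
  apply: (le_trans (ler_sum _ (fun u _ => bnd u))).
  rewrite big_split /= sumr_const -[_ *+ #|T|]mulr_natr natz mul0r add0r PoszD !PoszM.
  apply: lerD; last by rewrite mulrC.
  by rewrite (le_trans (sum_ind _ _ _)) // ler_wpM2r.
have sumZ : \sum_(t in T) \sum_(u in T) Z t u <=
    (#|T| * (K1 * q + K2 * q + q * M))%:Z.
  apply: (le_trans (ler_sum _ (fun t _ => rowE t))).
  rewrite big_split /= sumr_const -[_ *+ #|T|]mulr_natr natz.
  apply: (le_trans (lerD (sum_ind T E _) (lexx _))).
  have h1 : (#|E| * (q * #|T|) <= K1 * (q * #|T|))%N by rewrite leq_mul2r leE orbT.
  have h2 : (#|T| * M * #|T| <= q * M * #|T|)%N by rewrite !leq_mul2r TI !orbT.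
  by move: h1 h2; clear; move: #|E| #|T| => x y; lia.
apply: (le_trans (sqr_sum_le _ _)).
rewrite -mulnA [leRHS]PoszM ler_wpM2l //; apply: le_trans sumZ.
(* Extending the sum of squares from [S] to all [x] only adds nonnegative terms and produces full
   scalar products of columns. *)
apply: (@le_trans _ _ (\sum_x (\sum_(t in T) eps x t) ^+ 2)).
  by rewrite [leLHS]big_mkcond; apply: ler_sum => x _; case: ifP => // _; apply: sqr_ge0.
rewrite le_eqVlt; apply/orP; left; apply/eqP.
transitivity (\sum_x \sum_(t in T) \sum_(u in T) eps x t * eps x u).
  apply: eq_bigr => x _; rewrite expr2 mulr_suml.
  by apply: eq_bigr => t _; rewrite mulr_sumr.
rewrite exchange_big; apply: eq_bigr => t _; rewrite exchange_big.
by apply: eq_bigr.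
Qed.

Lemma floor_sqrt (q : nat) : exists s, (s * s <= q)%N /\ (q < s.+1 * s.+1)%N.
Proof.
elim: q => [|q [s [le lt]]]; first by exists 0%N.
have [eq|neq] := eqVneq q.+1 (s.+1 * s.+1)%N.
  by exists s.+1; rewrite eq leqnn; split => //; lia.
by exists s; split; [exact: leqW | rewrite ltn_neqAle neq].
Qed.

Lemma adj_sign_sum (F : finFieldType) (f : {poly {poly F}})
    (symf : square_symmetric f) (S T : {set Xgraph symf}) :
  \sum_(x in S) \sum_(t in T) adj_sign f x t =
  (edge_count S T)%:Z * 2 - (#|S| * #|T|)%:Z.
Proof.
have -> : (edge_count S T)%:Z = \sum_(x in S) \sum_(t in T) (Xadj f x t)%:Z.
  rewrite pair_big_dep /= /edge_count -[LHS]natz -sum1_card natr_sum.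
  rewrite big_mkcond [RHS]big_mkcond.
  by apply: eq_bigr => -[x t] _; rewrite !inE /= andbC; case: (Xadj f x t) => /=; case: ifP.
have -> : (#|S| * #|T|)%:Z = \sum_(x in S) \sum_(t in T) 1%:Z.
  by rewrite !sumr_const -mulrnA natz mulnC.
rewrite mulr_suml -sumrB; apply: eq_bigr => x _.
rewrite mulr_suml -sumrB; apply: eq_bigr => t _.
by rewrite /adj_sign; case: ifP.
Qed.

(** * Total degree and partial degrees *)

Section Degree.
Variable F : fieldType.

Lemma tdeg_size (f : {poly {poly F}}) : (size f <= (tdeg f).+1)%N.
Proof.
have [->|f0] := eqVneq f 0; first by rewrite size_poly0.
have lt : ((size f).-1 < size f)%N by rewrite prednK // size_poly_gt0.
have := @leq_bigmax_cond _ (fun i : 'I_(size f) => f`_i != 0)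
  (fun i : 'I_(size f) => (i + (size (f`_i)%R).-1)%N) (Ordinal lt).
rewrite /= -lead_coefE lead_coef_eq0 f0 => /(_ isT) le.
have : ((size f).-1 <= tdeg f)%N := leq_trans (leq_addr _ _) le.
by move: (size f) (tdeg f); clear; lia.
Qed.

Lemma tdeg_sizeY (f : {poly {poly F}}) : (sizeY f <= (tdeg f).+1)%N.
Proof.
apply/bigmax_leqP => i _; have [->|fi0] := eqVneq f`_i 0; first by rewrite size_poly0.
have := @leq_bigmax_cond _ (fun i : 'I_(size f) => f`_i != 0)
  (fun i : 'I_(size f) => (i + (size (f`_i)%R).-1)%N) i fi0.
move=> le; have : ((size (f`_i)%R).-1 <= tdeg f)%N := leq_trans (leq_addl _ _) le.
by move: (size (f`_i)%R) (tdeg f); clear; lia.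
Qed.

Lemma tdeg_leq (f : {poly {poly F}}) n :
  (forall i j, (n < i + j)%N -> f`_i`_j = 0) -> (tdeg f <= n)%N.
Proof.
move=> f0; apply/bigmax_leqP => i nz.
have szi : (0 < size (f`_i)%R)%N by rewrite size_poly_gt0.
rewrite leqNgt; apply/negP => /f0; rewrite -[X in X = _](_ : lead_coef f`_i = _) //.
by move/eqP; rewrite lead_coef_eq0 (negPf nz).
Qed.

Lemma coef_mul_tdeg (f g : {poly {poly F}}) m n :
  (forall i j, (m < i + j)%N -> f`_i`_j = 0) ->
  (forall i j, (n < i + j)%N -> g`_i`_j = 0) ->
  forall i j, (m + n < i + j)%N -> (f * g)`_i`_j = 0.
Proof.
move=> f0 g0 i j lt; rewrite coefM coef_sum big1 // => k _; rewrite coefM.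
apply: big1 => l _; have [lt1|le1] := ltnP m (k + l).
  by rewrite f0 // mul0r.
rewrite [(g`_ _)`_ _]g0 ?mulr0 //.
by case: k le1 => k; case: l => l /=; lia.
Qed.
End Degree.

(** The estimate is squared and cleared of denominators, with an integer [s] in place of the square
    root of [q], so that everything takes place in the integers. *)
Lemma X_family_discrepancy d : (1 <= d)%N ->
  exists K : nat, forall X, X_family d X ->
  forall S T : {set X}, exists s : nat, (s * s <= #|X|)%N /\
    ((edge_count S T)%:Z * 2 - (#|S| * #|T|)%:Z) ^+ 2 <=
      (#|S| * #|T| * (K * (#|X| * s)))%:Z.
Proof.
move=> d_ge1.
pose K1 := (d + (d + 2 * (3 ^ d * (d + d))))%N; pose m := (d + d)%N.
exists (K1 + m + (27 * m + 27 + 2 * (m + 2)))%N => X [F f adm_f oddF Df] S T.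
have f0 : f != 0.
  apply: contraTneq d_ge1 => f0.
  by rewrite -Df f0 /tdeg big_pred0 // => i; rewrite coef0 eqxx.
have szf : (size f <= d.+1)%N by rewrite -Df tdeg_size.
have szYf : (sizeY f <= d.+1)%N by rewrite -Df tdeg_sizeY.
have [s [le_s lt_s]] := floor_sqrt #|F|; exists s; split=> //.
(* Since [s] is positive, the terms of order [q] can be absorbed into multiples of [q * s]. *)
have s_gt0 : (0 < s)%N.
  rewrite lt0n; apply: contraTneq lt_s => ->.
  by rewrite -leqNgt (ltnW (finNzRing_gt1 F)).
have [E leE goodE] := generic_nonsquare_pairs oddF adm_f f0 szf szYf.
rewrite -adj_sign_sum.
have sz_ft t : (size (map_poly (horner_eval t) f) <= d.+1)%N.
  by apply: leq_trans (size_poly _ _) szf.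
pose M := (s * (27 * m + 27) + 2 * (m + 2))%N.
have good t : t \notin E -> exists2 B : {set F}, (#|B| <= d + d)%N &
     forall u, u \notin B -> \sum_x adj_sign f x t * adj_sign f x u <= M%:Z.
  move=> /goodE[B leB goodB]; exists B => // u /goodB nsq.
  apply: adj_sign_pair_sum => //; rewrite (leq_trans (size_polyMleq _ _)) //.
  have := sz_ft t; have := sz_ft u; rewrite /m.
  by set a := size _; set b := size _; clear; lia.
have sign1 x t u : adj_sign f x t * adj_sign f x u <= 1.
  by rewrite /adj_sign; do 2!case: ifP.
apply: (le_trans (bilinear_sum_bound S T sign1 leE good)).
rewrite lez_nat leq_mul2l; apply/orP; right.
rewrite -/K1 -/m /M; set q := #|F|.
have h1 : (K1 * q <= K1 * q * s)%N by rewrite leq_pmulr.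
have h2 : (m * q <= m * q * s)%N by rewrite leq_pmulr.
have h3 : (q * (2 * (m + 2)) <= q * (2 * (m + 2)) * s)%N by rewrite leq_pmulr.
by move: h1 h2 h3; clear; lia.
Qed.

(** * Admissible polynomials of every degree *)

Section Witness.
Variables (F : finFieldType) (d : nat).

(** Depending on [x + y] alone makes it symmetric; the exponent adjusts the total degree to
    [d.+1]. *)
Definition witness_poly : {poly {poly F}} :=
  ('X + 'X%:P) * ('X + 'X%:P + 1) ^+ d.

Lemma witness_eval (x y : F) :
  witness_poly.[x, y] = (x + y) * (x + y + 1) ^+ d.
Proof. by rewrite /witness_poly !(hornerE, horner_exp). Qed.

Lemma witness_symmetric : square_symmetric witness_poly.
Proof. by move=> u v; rewrite !witness_eval [v + u]addrC. Qed.

Lemma XaddXadd1 : 'X + 'X%:P + 1 = 'X + ('X + 1%:P)%:P :> {poly {poly F}}.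
Proof. by rewrite polyCD !polyC1 addrA. Qed.

Lemma witness_tdeg : tdeg witness_poly = d.+1.
Proof.
apply/eqP; rewrite eqn_leq; apply/andP; split.
  apply: tdeg_leq.
  have lin (c : F) i j : (1 < i + j)%N -> ('X + ('X + c%:P)%:P : {poly {poly F}})`_i`_j = 0.
    rewrite coefD coefX coefC; case: i => [|[|i]] /= lt.
    - by rewrite add0r coefD coefX coefC; case: j lt => [|[|j]] //=; rewrite addr0.
    - by rewrite addr0 coef1; case: j lt.
    - by rewrite addr0 coef0.
  rewrite /witness_poly -[d.+1]add1n; apply: coef_mul_tdeg.
    by have := lin 0; rewrite addr0.
  rewrite XaddXadd1; elim: d => [|k IHk] i j lt.
    by rewrite expr0 coef1; case: i lt => [|i] /= lt; rewrite ?coef1 ?coef0 //; case: j lt.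
  by rewrite exprS (coef_mul_tdeg (lin 1) IHk) // add1n.
have := tdeg_size witness_poly; rewrite {1}/witness_poly XaddXadd1.
rewrite size_Mmonic ?monic_neq0 ?monic_exp ?monicXaddC // size_XaddC.
set A := 'X + ('X + 1%:P)%:P; have szA : size (A ^+ d) = d.+1.
  rewrite -[LHS]prednK ?size_exp ?size_XaddC ?mul1n //.
  by rewrite size_poly_gt0 expf_neq0 ?monic_neq0 ?monicXaddC.
by rewrite szA.
Qed.

(* On the line x = -y the factor x + y vanishes and x + y + 1 does not, so
   x + y divides witness_poly exactly once. *)
Lemma witness_admissible : admissible witness_poly.
Proof.
split; first exact: witness_symmetric.
move=> H [_ [Fx [Gy Dw]]] [c [P DH]].
pose L : {poly {poly F}} := 'X - (- 'X)%:P.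
have LE : L = 'X + 'X%:P by rewrite /L polyCN opprK.
have w0 : witness_poly != 0.
  rewrite mulf_neq0 ?expf_neq0 // ?monic_neq0 ?monicXaddC //.
  by rewrite XaddXadd1 monicXaddC.
(* Under [x = -y] the one-variable factors and [c] stay nonzero, so the vanishing of the witness
   falls on [P]. *)
have nFG : Fx^:P.[- 'X] * Gy * c%:P != 0.
  have nz : Fx^:P * Gy%:P * (c%:P%:P * P ^+ 2) != 0 by rewrite -DH -Dw.
  have [[nF nG] nc] : (Fx^:P != 0 /\ Gy%:P != 0 :> {poly {poly F}}) /\ c != 0.
    split; [split|]; apply: contraNneq nz => z; rewrite ?z ?mul0r ?mulr0 ?mul0r //.
  rewrite !mulf_neq0 ?polyC_eq0 //; last by rewrite polyC_eq0 in nG.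
  rewrite -[_.[_]]/(Fx \Po - 'X) comp_poly_eq0 ?size_polyN ?size_polyX //.
  by rewrite map_polyC_eq0 in nF.
have rootP : root P (- 'X).
  have : witness_poly.[- 'X] = 0.
    by rewrite /witness_poly hornerM hornerD hornerX hornerC addNr mul0r.
  rewrite Dw DH !hornerM !hornerC => /eqP.
  by rewrite mulrA mulf_eq0 (negPf nFG) mulf_eq0 orbb.
have [Q DQ] := factor_theorem _ _ rootP; rewrite -/L in DQ.
have L0 : L != 0 by rewrite polyXsubC_eq0.
(* As [P] is divisible by [L], cancelling one [L] leaves another on the right. At [x = -y] the left
   side is 1 and the right side 0. *)
have : ('X + 'X%:P + 1) ^+ d = Fx^:P * Gy%:P * (c%:P%:P * Q ^+ 2 * L).
  by apply: (mulfI L0); rewrite {1}LE -[LHS]/witness_poly Dw DH DQ; ring.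
move/(congr1 (fun A => A.[- 'X])); rewrite horner_exp !hornerD hornerX !hornerC.
rewrite addNr add0r expr1n !hornerM [L.[_]](_ : _ = 0) ?mulr0 //.
  by move/eqP; rewrite oner_eq0.
by rewrite /L hornerXsubC subrr.
Qed.
End Witness.

(** Prime fields of large characteristic suffice; a prime above [N + 2] is odd. *)
Lemma X_family_unbounded d : (1 <= d)%N -> unbounded_order (X_family d).
Proof.
case: d => // d _ N; have [p ltp pr_p] := prime_above (N + 2).
exists (Xgraph (proj1 (@witness_admissible 'F_p d))).
  apply: XFamily; last exact: witness_tdeg.
  rewrite card_Fp //; case: (even_prime pr_p) => // p2.
  by move: ltp; rewrite p2; lia.
by rewrite /= card_Fp //; lia.
Qed.

Theorem theorem1p4 (R : realType) (d : nat) (d_ge1 : (1 <= d)%N) :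
  has_QR (3 / 4 : R) (X_family d).
Proof.
split; first exact: X_family_unbounded.
have [K boundK] := X_family_discrepancy d_ge1.
(* The successor makes the constant positive, and its square is at least [K], so no square root of
   [K] has to be taken. *)
exists (K.+1%:R : R) => [|X famX S T]; first by rewrite ltr0n.
have [s [le_s leD]] := boundK X famX S T.
set q := #|X| in le_s leD *; set n := (#|S| * #|T|)%N in leD *.
set e := edge_count S T in leD *.
have leD' : (e%:R * 2 - n%:R : R) ^+ 2 <= n%:R * (K%:R * (q%:R * s%:R)).
  have := leD; rewrite -(ler_int R) rmorphXn rmorphB rmorphM /= -!pmulrn.
  by rewrite !natrM.
have s_le : s%:R <= Num.sqrt q%:R :> R.
  by rewrite -(ler_pXn2r (n := 2)) ?nnegrE ?sqrtr_ge0 // sqr_sqrtr // expr2 -natrM ler_nat.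
(* This is where the exponent 3/4 comes from: the squared discrepancy is of order [q * s], that is
   [q^(3/2)]. *)
have q34 : (q%:R `^ (3 / 4)) ^+ 2 = q%:R * Num.sqrt q%:R :> R.
  have [->|q_gt0] := posnP q.
    by rewrite powR0 ?expr0n ?mul0r // lt0r_neq0 //; lra.
  rewrite -powR12_sqrt // -powR_mulrn ?powR_ge0 // -powRrM.
  rewrite -{2}[q%:R]powRr1 // -powRD ?pnatr_eq0 -?lt0n ?q_gt0 ?implybT //.
  by congr (_ `^ _); lra.
have -> : e%:R - n%:R / 2 = (e%:R * 2 - n%:R) / 2 :> R by field.
rewrite normrM [`|2^-1|]ger0_norm ?invr_ge0 //.
apply: (@le_trans _ _ `|e%:R * 2 - n%:R|).
  by rewrite ler_piMr // invf_le1 // ler1n.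
rewrite -(ler_pXn2r (n := 2)) ?nnegrE ?mulr_ge0 ?powR_ge0 ?sqrtr_ge0 //.
rewrite real_normK ?num_real // (le_trans leD') // !exprMn q34 sqr_sqrtr //.
rewrite mulrC ler_wpM2r // ler_pM ?mulr_ge0 //.
  by rewrite -natrX ler_nat (leq_trans (leqnSn K)) // leq_pmulr.
by rewrite ler_wpM2l.
Qed.
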